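(* Let $\phi(x)=x[\log(e+x)]^\alpha$ with $0<\alpha<\frac12$. Then there cannot be any $(\phi,1)$-sparse domination for the strong maximal function or for bi-parameter martingale transforms. That is, for every $C>0$ and $0<\eta<1$: (i) there exist compactly supported integrable functions $f,g$ on $\mathbb{R}^2$ such that $|\langle\mathcal{M}_Sf,g\rangle|>C\sum_{R\in\mathcal{S}}\langle|f|\rangle_{R,\phi}\langle|g|\rangle_R|R|$ for all $\eta$-sparse collections $\mathcal{S}$ of dyadic rectangles; (ii) there exist a sequence $\sigma=\{\sigma_R\}$ indexed by the dyadic rectangles, with $|\sigma_R|\le1$, and compactly supported integrable functions $f,g$ on $\mathbb{R}^2$ such that the series defining $\langle T_\sigma f,g\rangle$ converges absolutely and $|\langle T_\sigma f,g\rangle|>C\sum_{R\in\mathcal{S}}\langle|f|\rangle_{R,\phi}\langle|g|\rangle_R|R|$ for all $\eta$-sparse collections $\mathcal{S}$ of dyadic rectangles.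
   Context: A dyadic interval is an interval $[j2^n,(j+1)2^n)$ with $j,n\in\mathbb{Z}$; a dyadic rectangle in $\mathbb{R}^2$ is a product $R=I\times J$ of two dyadic intervals. $\langle h\rangle_R=\frac1{|R|}\int_Rh$ and $\langle u,v\rangle=\int uv$. The dyadic strong maximal function is $\mathcal{M}_Sf(x)=\sup_{R\ni x}\langle|f|\rangle_R$, supremum over dyadic rectangles containing $x$. For nonnegative $f$, $$\langle f\rangle_{R,\phi}=\inf\Bigl\{\lambda>0:\frac1{|R|}\int_R\phi\Bigl(\frac{f(x)}{\lambda}\Bigr)dx\le1\Bigr\}.$$ For a dyadic interval $I$, $h_I=|I|^{-1/2}(\mathbf{1}_{I_{\text{left}}}-\mathbf{1}_{I_{\text{right}}})$ is the Haar function, where $I_{\text{left}},I_{\text{right}}$ are the two dyadic children; for $R=I\times J$, $h_R(x,y)=h_I(x)h_J(y)$. Given $\sigma=\{\sigma_R\}_R$ with $|\sigma_R|\le1$, the bi-parameter martingale transform is $T_\sigma f=\sum_R\sigma_R\langle f,h_R\rangle h_R$ (sum over all dyadic rectangles), and $\langle T_\sigma f,g\rangle=\sum_R\sigma_R\langle f,h_R\rangle\langle g,h_R\rangle$. A collection $\mathcal{S}$ of sets is $\eta$-sparse if for every $R\in\mathcal{S}$ there is a (measurable) $E(R)\subseteq R$ with $|E(R)|\ge\eta|R|$ such that the sets $E(R)$ are pairwise disjoint. *)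

(* Defs.v *)
From mathcomp Require Import all_boot all_order all_algebra.
From mathcomp Require Import all_classical all_reals all_analysis.

Set Implicit Arguments.
Unset Strict Implicit.
Unset Printing Implicit Defensive.

Import Order.TTheory GRing.Theory Num.Theory.
Import numFieldNormedType.Exports.

Local Open Scope classical_set_scope.
Local Open Scope ring_scope.

(* The pair (n, j) encodes the dyadic interval [j 2^n, (j+1) 2^n[; this encoding
   is injective, so a set of codes is the same thing as a collection of dyadic
   rectangles. *)
Definition dyadic_interval : Type := (int * int)%type.
Definition dyadic_rectangle : Type := (dyadic_interval * dyadic_interval)%type.

Definition left_child (I : dyadic_interval) : dyadic_interval :=
  (I.1 - 1, 2 * I.2).
Definition right_child (I : dyadic_interval) : dyadic_interval :=
  (I.1 - 1, 2 * I.2 + 1).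

Section dyadic.
Context (R : realType).
Local Notation plane := (R * R)%type.

Definition interval_set (I : dyadic_interval) : set R :=
  `[I.2%:~R * 2 ^ I.1, (I.2 + 1)%:~R * 2 ^ I.1[%classic.

Definition rect (Q : dyadic_rectangle) : set plane :=
  interval_set Q.1 `*` interval_set Q.2.

Definition leb2 :
    {measure set (measurableTypeR R * measurableTypeR R) -> \bar R} :=
  (@lebesgue_measure R \x @lebesgue_measure R)%E.

Definition len (I : dyadic_interval) : R :=
  fine (@lebesgue_measure R (interval_set I)).

Definition area (Q : dyadic_rectangle) : R := fine (leb2 (rect Q)).

Definition compactly_supported (f : plane -> R) : Prop :=
  compact (closure [set z | f z != 0]).

Definition integrable2 (f : plane -> R) : Prop :=
  leb2.-integrable setT (EFin \o f).

Definition avg (h : plane -> R) (Q : dyadic_rectangle) : \bar R :=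
  ((area Q)^-1%:E * \int[leb2]_(z in rect Q) (h z)%:E)%E.

Definition strong_maximal (f : plane -> R) (z : plane) : \bar R :=
  ereal_sup [set avg (fun w => `|f w|) Q | Q in [set Q | rect Q z]].

(* The value is +oo when no lambda is admissible. *)
Definition orlicz_avg (phi : R -> R) (h : plane -> R) (Q : dyadic_rectangle)
    : \bar R :=
  ereal_inf [set l%:E | l in
    [set l : R | 0 < l /\ (avg (fun w => phi (h w / l)%R) Q <= 1)%E]].

Definition haar (I : dyadic_interval) (x : R) : R :=
  len I `^ (- 2^-1) *
  (\1_(interval_set (left_child I)) x - \1_(interval_set (right_child I)) x).

Definition haar2 (Q : dyadic_rectangle) (z : plane) : R :=
  haar Q.1 z.1 * haar Q.2 z.2.

Definition pairing (u v : plane -> \bar R) : \bar R :=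
  (\int[leb2]_z (u z * v z))%E.

Definition haar_coef (f : plane -> R) (Q : dyadic_rectangle) : R :=
  fine (pairing (EFin \o f) (EFin \o haar2 Q)).

Definition martingale_term (sigma : dyadic_rectangle -> R) (f g : plane -> R)
    (Q : dyadic_rectangle) : \bar R :=
  (sigma Q * haar_coef f Q * haar_coef g Q)%:E.

(* [esum] is only meaningful for nonnegative families, hence the splitting; the
   result is the sum of the series as soon as the family is [summable]. *)
Definition martingale_pairing (sigma : dyadic_rectangle -> R)
    (f g : plane -> R) : \bar R :=
  (esum setT (martingale_term sigma f g)^\+
   - esum setT (martingale_term sigma f g)^\-)%E.

Definition sparse (eta : R) (S : set dyadic_rectangle) : Prop :=
  exists E : dyadic_rectangle -> set (measurableTypeR R * measurableTypeR R),
    (forall Q, S Q -> [/\ measurable (E Q), E Q `<=` rect Q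
      & (eta%:E * leb2 (rect Q) <= leb2 (E Q))%E]) /\
    trivIset S E.

Definition sparse_form (phi : R -> R) (S : set dyadic_rectangle)
    (f g : plane -> R) : \bar R :=
  (\esum_(Q in S) (orlicz_avg phi (fun z => `|f z|%R) Q
                   * avg (fun z => `|g z|%R) Q * (area Q)%:E))%E.

Definition xlog_pow (alpha x : R) : R := x * ln (expR 1 + x) `^ alpha.

End dyadic.

(* Main.v *)
(** Write points of the unit square through their binary digits.  With [k] large,
  [N = 4^k] and [m = N + k - 1], let [f] be the uniform probability density on the
  [2^m] cells of side [2^-m] whose [x]-digits [u] and [y]-digits read backwards
  agree: a dyadic subrectangle of the square of area [2^-m] and sides at least
  [2^-m] contains exactly one cell.  Let [g] be
  the average over [s < N] of the uniform densities on the cells whose two digit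
  strings agree exactly on the window [[s, s + k)].
  Fixing the first [a] digits of [x] and [b] digits of [y] leaves an overlap of
  [j = (a + b - m)^+] positions.  If the rectangle meets [f], the prescribed digits
  agree there, so only the windows containing the overlap contribute to [g]: at
  most [k - j + 1 <= 4^(k - j)] of them.  Hence [<f> <= 2^j] and [<g> <= 2^-j], and
  since [f <= 2^m] the Orlicz average of [f] costs only a further factor
  [(m + 2)^alpha].  Rectangles leaving the unit square gain geometric factors, so
  every sparse form is at most [16 (m + 2)^alpha / eta], i.e. about [4^(k alpha)].
  On the other hand prescribing all digits, the window twice, gives a rectangle of
  area [2^-(m + k)] containing one cell of [f] and one of [g]: the maximal function
  is at least [2^k] on the support of [g], and summing
  [|<f, h_R> <g, h_R>|] over such rectangles gives [2^k (N - 2) / N].  For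
  [alpha < 1/2] these beat the sparse bound. *)
Require Import Defs.
From mathcomp Require Import all_boot all_order all_algebra.
From mathcomp Require Import finmap.
From mathcomp Require Import all_classical all_reals all_analysis.
From mathcomp Require Import measurable_realfun.
From mathcomp Require Import zify ring lra.
Set Implicit Arguments.
Unset Strict Implicit.
Unset Printing Implicit Defensive.
Import Order.TTheory GRing.Theory Num.Theory.
Import numFieldNormedType.Exports.
Local Open Scope classical_set_scope.
Local Open Scope ring_scope.

(** * Binary strings as codes of dyadic intervals *)

Fixpoint bits_val_rev (s : seq bool) : nat :=
  if s is b :: s' then (2 * bits_val_rev s' + b)%N else 0%N.

(* The head of [s] is the most significant digit. *)
Definition bits_val (s : seq bool) : nat := bits_val_rev (rev s).

(** The points of the unit interval whose binary expansion starts with [s]; extending the string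
    shrinks the interval. *)
Definition code (s : seq bool) : dyadic_interval :=
  (- (size s)%:Z, (bits_val s)%:Z).

Lemma bits_val_rcons s b : bits_val (rcons s b) = (2 * bits_val s + b)%N.
Proof. by rewrite /bits_val rev_rcons. Qed.

Lemma code_rcons s b :
  code (rcons s b) = if b then right_child (code s) else left_child (code s).
Proof.
rewrite /code bits_val_rcons size_rcons /right_child /left_child /=.
by case: b => /=; congr pair; lia.
Qed.

(** Leading zeros do not change the value, hence the condition on sizes; the last digit is recovered
    by parity. *)
Lemma bits_val_inj s t : size s = size t -> bits_val s = bits_val t -> s = t.
Proof.
elim/last_ind: s t => [|s b IH] t; first by case: t.
elim/last_ind: t => [|t c _]; first by rewrite size_rcons.
rewrite !size_rcons !bits_val_rcons => -[sz] e.
by have [-> ->] : s = t /\ b = c by split; [apply: IH => //|]; lia.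
Qed.

(** * Nesting and length of dyadic intervals *)

Section intervals.
Context {R : realType}.

Lemma interval_setE (I : dyadic_interval) (x : R) :
  interval_set I x <-> I.2%:~R * 2 ^ I.1 <= x < (I.2 + 1)%:~R * 2 ^ I.1.
Proof. by rewrite /interval_set /= in_itv /=. Qed.

(** Membership becomes an equation for the index, so only one interval of each level passes through
    a given point. *)
Lemma interval_set_floor (I : dyadic_interval) (x : R) :
  interval_set I x <-> Num.floor (x * 2 ^ (- I.1)) = I.2.
Proof.
rewrite interval_setE -invr_expz; have h : 0 < (2 : R) ^ I.1 by rewrite exprz_gt0.
rewrite -ler_pdivlMr // -[_ < _]ltr_pdivrMr //.
by split=> [h'|<-]; [apply: floor_def | rewrite floor_le_tmp /= lt_succ_floor].
Qed.

Lemma interval_set_inj (I J : dyadic_interval) (x : R) :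
  interval_set I x -> interval_set J x -> I.1 = J.1 -> I = J.
Proof.
case: I J => [n i] [n' j] /interval_set_floor /= hi /interval_set_floor /= hj e.
by subst n'; rewrite -hi -hj.
Qed.

Lemma children_split (I : dyadic_interval) (x : R) :
  interval_set I x <->
  interval_set (left_child I) x \/ interval_set (right_child I) x.
Proof.
rewrite !interval_setE /=; case: I => n j /=.
have -> : (2 : R) ^ n = 2 * 2 ^ (n - 1).
  by rewrite expfzDr // exprN1 mulrCA divff ?mulr1.
have h : 0 < (2 : R) ^ (n - 1) by rewrite exprz_gt0.
set y := _ ^ _ in h *; rewrite !(rmorphD, rmorphM) /=.
split; last by case=> /andP[h1 h2]; apply/andP; split; nra.
by case: (ltP x ((2 * j%:~R + 1) * y)) => h1 /andP[h2 h3];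
  [left|right]; apply/andP; split; nra.
Qed.

Lemma code_rcons_sub s b (x : R) :
  interval_set (code (rcons s b)) x -> interval_set (code s) x.
Proof. by rewrite code_rcons => h; apply/children_split; case: b h; [right|left]. Qed.

Lemma code_cat_sub s t (x : R) :
  interval_set (code (s ++ t)) x -> interval_set (code s) x.
Proof.
elim/last_ind: t => [|t b IH]; first by rewrite cats0.
by rewrite -rcons_cat => /code_rcons_sub.
Qed.

Lemma code_prefix_sub s t (x : R) :
  prefix s t -> interval_set (code t) x -> interval_set (code s) x.
Proof. by move=> /prefixP[r ->]; apply: code_cat_sub. Qed.

(** Truncating [t] to the length of [s] gives an interval through [x] of the same level as [code s],
    hence the same interval. This is the nesting of dyadic intervals that meet. *)
Lemma code_meet_prefix s t (x : R) : (size s <= size t)%N ->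
  interval_set (code s) x -> interval_set (code t) x -> prefix s t.
Proof.
move=> st xs xt; have xt' : interval_set (code (take (size s) t)) x.
  by apply: code_cat_sub (drop (size s) t) _ _; rewrite cat_take_drop.
have szt : size (take (size s) t) = size s by rewrite size_takel.
have e : code s = code (take (size s) t).
  by apply: interval_set_inj xs xt' _; rewrite /= szt.
rewrite prefixE; apply/eqP/esym/bits_val_inj => //.
by have [] := congr1 snd e.
Qed.

Lemma code_nil : code [::] = (0, 0). Proof. by []. Qed.

Lemma unit_code (a : nat) (x : R) : interval_set (0, 0) x ->
  exists2 s, size s = a & interval_set (code s) x.
Proof.
move=> x01; elim: a => [|a [s <- xs]]; first by exists [::].
have [h|h] := (children_split _ _).1 xs.
  by exists (rcons s false); rewrite ?size_rcons ?code_rcons.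
by exists (rcons s true); rewrite ?size_rcons ?code_rcons.
Qed.

Lemma unit_code_le0 (I : dyadic_interval) (x : R) : I.1 <= 0 ->
  interval_set (0, 0) x -> interval_set I x ->
  exists2 s, size s = `|I.1|%N & I = code s.
Proof.
move=> n0 x01 xI; have [s ss xs] := unit_code `|I.1| x01; exists s => //.
by apply: interval_set_inj xI xs _; rewrite /= ss; lia.
Qed.

Lemma unit_sub_ge0 (n : int) (x : R) : 0 <= n ->
  interval_set (0, 0) x -> interval_set (n, 0) x.
Proof.
move=> n0; rewrite !interval_setE /= !mul0r !mul1r expr0z => /andP[-> h] /=.
by apply: lt_le_trans h _; case: n n0 => // n _; rewrite exprn_ege1 // ler1n.
Qed.

Lemma unit_ge0 (I : dyadic_interval) (x : R) : 0 <= I.1 ->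
  interval_set (0, 0) x -> interval_set I x -> I = (I.1, 0).
Proof.
by move=> n0 /(unit_sub_ge0 n0) x0 xI; apply: interval_set_inj xI x0 _.
Qed.

Lemma measurable_interval_set (I : dyadic_interval) :
  measurable (interval_set I : set (measurableTypeR R)).
Proof. exact: measurable_itv. Qed.

Lemma lebesgue_interval_set (I : dyadic_interval) :
  @lebesgue_measure R (interval_set I) = (2 ^ I.1)%:E.
Proof.
rewrite /interval_set lebesgue_measure_itv /= lte_fin.
rewrite ltr_pM2r ?exprz_gt0 // ltr_int ltzD1 lexx -EFinD -mulrBl -rmorphB /=.
by rewrite addrAC subrr add0r mul1r.
Qed.

Lemma lenE (I : dyadic_interval) : len R I = 2 ^ I.1 :> R.
Proof. by rewrite /len lebesgue_interval_set. Qed.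

End intervals.

(** * Area of rectangles and integrals of simple functions *)

Section plane.
Context {R : realType}.
Local Notation plane := (measurableTypeR R * measurableTypeR R)%type.

Lemma leb2_setX (A B : set (measurableTypeR R)) : measurable A -> measurable B ->
  leb2 R (A `*` B) = (@lebesgue_measure R A * @lebesgue_measure R B)%E.
Proof. by move=> mA mB; rewrite /leb2 /= product_measure1E. Qed.

Lemma measurable_rect Q : measurable (rect Q : set plane).
Proof. by apply: measurableX; exact: measurable_interval_set. Qed.

Lemma leb2_rect Q : leb2 R (rect Q) = ((2 : R) ^ Q.1.1 * 2 ^ Q.2.1)%:E.
Proof.
rewrite leb2_setX; try exact: measurable_interval_set.
by rewrite !lebesgue_interval_set.
Qed.

Lemma areaE Q : area R Q = 2 ^ Q.1.1 * 2 ^ Q.2.1.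
Proof. by rewrite /area leb2_rect. Qed.

Lemma area_gt0 Q : 0 < area R Q.
Proof. by rewrite areaE mulr_gt0 // exprz_gt0. Qed.

Lemma integrable_fin_indic (A : set plane) D : measurable D -> measurable A ->
  (leb2 R A < +oo)%E -> (leb2 R).-integrable D (fun z => (\1_A z)%:E).
Proof.
move=> mD mA fA; apply/integrableP; split.
  by apply/measurable_EFinP; exact: measurable_indic.
rewrite (eq_integral (fun z => (\1_A z)%:E)); last first.
  by move=> z _; rewrite gee0_abs // lee_fin.
rewrite integral_indic //; apply: le_lt_trans fA.
by apply: le_measure => //; rewrite ?inE //; exact: measurableI.
Qed.

Lemma integrable_simple (K : finType) (a : K -> R) (A : K -> set plane) D :
  measurable D -> (forall i, measurable (A i)) ->
  (forall i, (leb2 R (A i) < +oo)%E) ->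
  (leb2 R).-integrable D (fun z => (\sum_i a i * \1_(A i) z)%:E).
Proof.
move=> mD mA fA.
rewrite (_ : (fun z => _) = (fun z => (\sum_i (a i)%:E * (\1_(A i) z)%:E)%E)).
  apply: (integrable_sum mD) => i _; apply: (integrableZl mD).
  exact: integrable_fin_indic.
by apply/funext => z; rewrite -sumEFin.
Qed.

Lemma integral_simple (K : finType) (a : K -> R) (A : K -> set plane) D :
  measurable D -> (forall i, measurable (A i)) ->
  (forall i, (leb2 R (A i) < +oo)%E) ->
  (\int[leb2 R]_(z in D) (\sum_i a i * \1_(A i) z)%:E)%E =
  (\sum_i a i * fine (leb2 R (A i `&` D)))%:E.
Proof.
move=> mD mA fA.
under eq_integral do rewrite -sumEFin.
have iA i : (leb2 R).-integrable D (fun z => (\1_(A i) z)%:E).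
  exact: integrable_fin_indic.
rewrite integral_sum //; last first.
  move=> i; rewrite (_ : (fun x => _) = (fun z => (a i)%:E * (\1_(A i) z)%:E)%E) //.
  exact: integrableZl.
rewrite -sumEFin; apply: eq_bigr => i _.
rewrite (_ : (fun z => _) = (fun z => (a i)%:E * (\1_(A i) z)%:E)%E) //.
rewrite integralZl // integral_indic // EFinM fineK //.
rewrite ge0_fin_numE //; apply: le_lt_trans (fA i).
by apply: le_measure => //; rewrite ?inE //; exact: measurableI.
Qed.

End plane.

(** * Cells, truncated digit strings and averages of step functions *)

Definition cell (s t : seq bool) : dyadic_rectangle := (code s, code t).

(** Positive and negative parts of the level: the first measures how far the interval exceeds length
    1, the second counts the digits it prescribes inside the unit interval. *)
Definition pos_level (I : dyadic_interval) : nat := `|Num.max I.1 0|%N.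
Definition neg_level (I : dyadic_interval) : nat := `|Num.min I.1 0|%N.

Lemma pos_negE I : I.1 = (pos_level I)%:Z - (neg_level I)%:Z.
Proof. by rewrite /pos_level /neg_level; lia. Qed.

Section overlap.
Context {R : realType}.
Local Notation plane := (measurableTypeR R * measurableTypeR R)%type.

(* [p] lists the first [min (neg_level I, m)] binary digits common to the points of
   [I]; it is junk when [I] misses the unit interval. *)
Definition truncates m (I : dyadic_interval) (p : seq bool) : Prop :=
  size p = minn (neg_level I) m /\
  forall u : m.-tuple bool,
    (forall x : R, interval_set (code u) x -> interval_set I x -> prefix p u) /\
    (@lebesgue_measure R (interval_set (code u) `&` interval_set I) <=
     (2 ^ I.1 * 2^-1 ^+ pos_level I * 2 ^+ size p * 2^-1 ^+ m)%:E)%E.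

(** The level is [pos_level I - neg_level I], so the measure bound in [truncates] equals
    [2^-max(neg_level I, m)]: the side of a cell if [I] prescribes at most [m] digits, the length of
    [I] otherwise. *)
Lemma truncation_exists m (I : dyadic_interval) : exists p, truncates m I p.
Proof.
rewrite /truncates; have iu u : size u = m -> (2 : R) ^ (code u).1 = 2^-1 ^+ m.
  by move=> su; rewrite /= su exprVn -exprnN.
have mI J := @measurable_interval_set R J.
have leu u : size u = m ->
    (@lebesgue_measure R (interval_set (code u) `&` interval_set I) <=
     (2^-1 ^+ m)%:E)%E.
  move=> su; rewrite -(iu u su) -lebesgue_interval_set.
  by apply: le_measure; rewrite ?inE //; exact: measurableI.
have leI u :
    (@lebesgue_measure R (interval_set (code u) `&` interval_set I) <=
     (2 ^ I.1)%:E)%E.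
  rewrite -lebesgue_interval_set.
  by apply: le_measure; rewrite ?inE //; exact: measurableI.
case: (ltP 0 I.1) => n0.
  have neg0 : neg_level I = 0%N by rewrite /neg_level; lia.
  exists [::]; split; first by rewrite neg0 min0n.
  move=> u; split=> [*|]; [exact: prefix0s|rewrite expr0 mulr1].
  have -> : I.1 = (pos_level I)%:Z by rewrite pos_negE neg0 subr0.
  by rewrite exprVn divff ?expf_neq0 // mul1r leu // size_tuple.
have pos0 : pos_level I = 0%N by rewrite /pos_level; lia.
rewrite pos0 expr0 mulr1.
have [[x [x01 xI]]|dis] :=
  pselect (exists x : R, interval_set (0, 0) x /\ interval_set I x).
  have [s ss Is] := unit_code_le0 n0 x01 xI.
  have negs : neg_level I = size s by rewrite ss /neg_level; lia.
  exists (take m s); split; first by rewrite negs size_take_min minnC.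
  move=> u; have su : size u = m by rewrite size_tuple.
  case: (leqP (size s) m) => sm.
    rewrite take_oversize //; split=> [y yu|].
      by rewrite Is => yI; apply: code_meet_prefix yI yu; rewrite su.
    rewrite Is /= -exprnN.
    by rewrite -exprVn -exprMn mulVf // expr1n mul1r -Is leu.
  rewrite size_takel 1?ltnW //; split=> [y yu|].
    rewrite Is => yI; have us : prefix u s.
      by apply: code_meet_prefix yu yI; rewrite su ltnW.
    by move: us; rewrite prefixE su => /eqP ->; apply: prefix_refl.
  by rewrite -mulrA -exprMn divff // expr1n mulr1.
(* No cell meets [I], so any string of the right length serves. *)
exists (nseq (minn (neg_level I) m) false); split; first by rewrite size_nseq.
move=> u; have e : interval_set (code u) `&` interval_set I = set0 :> set R.
  apply/seteqP; split=> // y [yu yI]; apply: dis; exists y; split=> //.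
  by rewrite -code_nil; apply: code_prefix_sub yu; exact: prefix0s.
split=> [y yu yI|]; first by have : (set0 : set R) y by rewrite -e.
rewrite e measure0 lee_fin !mulr_ge0 ?exprz_ge0 ?exprn_ge0 //.
Qed.

Section step.
Context {K : finType} {m : nat} (c : R) (x y : K -> m.-tuple bool).

(** Common shape of [diag] and [windows]; indexing the cells by [K] turns averages into counts of
    indices. *)
Definition step (z : R * R) : R :=
  \sum_i c * \1_(rect (cell (x i) (y i))) z.

Lemma leb2_cell s t : leb2 R (rect (cell s t)) =
  (2^-1 ^+ size s * 2^-1 ^+ size t)%:E.
Proof. by rewrite leb2_rect /= -!exprnN !exprVn. Qed.

Lemma step_ge0 z : 0 <= c -> 0 <= step z.
Proof. by move=> c0; apply: sumr_ge0 => i _; rewrite mulr_ge0. Qed.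

Lemma step_neq0 z : step z != 0 -> exists i, rect (cell (x i) (y i)) z.
Proof.
move=> nz; apply: contrapT => h; case/eqP: nz; apply: big1 => i _.
by rewrite indicE memNset ?mulr0 // => zi; apply: h; exists i.
Qed.

Lemma cell_unit s t (z : R * R) : rect (cell s t) z -> rect (cell [::] [::]) z.
Proof.
move=> [/= h1 h2]; split; [apply: code_prefix_sub h1|apply: code_prefix_sub h2];
  exact: prefix0s.
Qed.

Lemma step_compact : compactly_supported step.
Proof.
have c01 : closed (`[0, 1]%classic : set R) by exact: itv_closed.
have sub : closure [set z | step z != 0] `<=` `[0, 1]%classic `*` `[0, 1]%classic.
  have cl : closed ((`[0, 1]%classic `*` `[0, 1]%classic) : set (R * R)).
    rewrite (_ : _ `*` _ = (fst @^-1` `[0, 1]%classic) `&` (snd @^-1` `[0, 1]%classic)) //.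
    by apply: closedI; apply: (iffLR (continuous_closedP _) _ _ c01) => z;
      [exact: cvg_fst|exact: cvg_snd].
  rewrite [X in _ `<=` X](closure_id _).1 //; apply: closureS => z /= /step_neq0[i].
  move=> /cell_unit[]; rewrite !interval_setE /= !in_itv /= expr0z !mul0r !mul1r.
  by move=> /andP[-> /ltW ->] /andP[-> /ltW ->].
apply: subclosed_compact sub; first exact: closed_closure.
by apply: compact_setX; exact: segment_compact.
Qed.

Lemma step_measurable_cell i : measurable (rect (cell (x i) (y i)) : set plane).
Proof. exact: measurable_rect. Qed.

Lemma step_finite_cell i : (leb2 R (rect (cell (x i) (y i))) < +oo)%E.
Proof. by rewrite leb2_cell ltry. Qed.

Lemma step_integrable : integrable2 step.
Proof.
apply: integrable_simple => //; [exact: step_measurable_cell|exact: step_finite_cell].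
Qed.

Lemma step_measurable (D : set plane) : measurable_fun D (step : plane -> R).
Proof.
apply: measurable_sum => i; apply: measurable_funM; first exact: measurable_cst.
by apply: measurable_indic; exact: measurable_rect.
Qed.

Lemma integral_step (D : set plane) : measurable D ->
  (\int[leb2 R]_(z in D) (step z)%:E)%E =
  (\sum_i c * fine (leb2 R (rect (cell (x i) (y i)) `&` D)))%:E.
Proof.
by move=> mD; rewrite integral_simple //;
  [exact: step_measurable_cell|exact: step_finite_cell].
Qed.

Lemma truncates_step (Q : dyadic_rectangle) p q z :
  truncates m Q.1 p -> truncates m Q.2 q -> rect Q z -> step z != 0 ->
  exists i, prefix p (x i) && prefix q (y i).
Proof.
move=> [_ hp] [_ hq] [z1 z2] /step_neq0[i [/= zx zy]]; exists i.
by rewrite ((hp _).1 z.1) //= ((hq _).1 z.2).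
Qed.

(** Only cells whose strings extend [p] and [q] can meet [Q], each in measure at most the product of
    the two bounds of [truncates]. Dividing by the area cancels the side lengths of [Q]. *)
Lemma avg_step_le (Q : dyadic_rectangle) p q : 0 <= c ->
  truncates m Q.1 p -> truncates m Q.2 q ->
  (avg step Q <= (c * (2^-1 ^+ pos_level Q.1 * 2^-1 ^+ pos_level Q.2) *
    (2 ^+ (size p + size q) * 2^-1 ^+ (m + m)) *
    #|[pred i | prefix p (x i) && prefix q (y i)]|%:R)%:E)%E.
Proof.
move=> c0 [_ hp] [_ hq].
rewrite /avg integral_step; last exact: measurable_rect.
rewrite -EFinM lee_fin mulrC ler_pdivrMr ?area_gt0 // areaE.
rewrite -sum1_card natr_sum mulr_sumr mulr_suml [leRHS]big_mkcond /=.
apply: ler_sum => i _; rewrite inE.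
have -> : rect (cell (x i) (y i)) `&` rect Q =
    (interval_set (code (x i)) `&` interval_set Q.1) `*`
    (interval_set (code (y i)) `&` interval_set Q.2) :> set (R * R).
  by rewrite setXI.
rewrite leb2_setX; try by apply: measurableI; exact: measurable_interval_set.
have [hpi lep] := hp (x i); have [hqi leq] := hq (y i).
case: ifPn => [_|].
  rewrite mulr1 -!mulrA ler_wpM2l //.
  have := lee_pmul (measure_ge0 _ _) (measure_ge0 _ _) lep leq.
  rewrite -EFinM => h; apply: le_trans (_ : _ <= fine (_%:E)) _;
    first apply: (fine_le _ _ h) => //.
    rewrite ge0_fin_numE ?mule_ge0 ?measure_ge0 //.
    by apply: le_lt_trans h _; rewrite ltry.
  by rewrite /= !exprD le_eqVlt; apply/orP; left; apply/eqP; ring.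
rewrite negb_and => /orP nz.
suff -> : (@lebesgue_measure R (interval_set (code (x i)) `&` interval_set Q.1) *
  @lebesgue_measure R (interval_set (code (y i)) `&` interval_set Q.2))%E = 0%E.
  by rewrite /= mulr0.
case: nz => [/negP np|/negP nq].
  rewrite (_ : _ `&` _ = set0) ?measure0 ?mul0e //.
  by apply/seteqP; split=> // t [t1 /(hpi t t1)].
rewrite [X in (_ * lebesgue_measure X)%E](_ : _ `&` _ = set0) ?measure0 ?mule0 //.
by apply/seteqP; split=> // t [t1 /(hqi t t1)].
Qed.

End step.
End overlap.

(** * Counting digit strings with prescribed ends *)

Lemma prefix_nth (p u : seq bool) t : prefix p u -> (t < size p)%N ->
  nth false u t = nth false p t.
Proof. by move=> /prefixP[r ->] tp; rewrite nth_cat tp. Qed.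

Lemma prefix_rev_nth (q u : seq bool) t : prefix q (rev u) ->
  (t < size u)%N -> (size u - size q <= t)%N ->
  nth false u t = nth false q (size u - t.+1).
Proof.
move=> qu tu h; rewrite -(prefix_nth qu); last by lia.
by rewrite nth_rev; [congr nth; lia|lia].
Qed.

(** An element of [P] is determined by its [m - (a + b)] middle digits. When [a + b] reaches [m] the
    exponent is 0 and at most one string remains. *)
Lemma card_free_bits m a b (P : pred (m.-tuple bool)) :
  (forall u v, P u -> P v -> forall t, (t < m)%N ->
    (t < a)%N || (m - b <= t)%N -> nth false u t = nth false v t) ->
  (#|P| <= 2 ^ (m - (a + b)))%N.
Proof.
move=> hP; pose h (u : m.-tuple bool) :=
  [ffun i : 'I_(m - (a + b)) => nth false u (a + i)].
rewrite -(card_in_image (f := h) (A := P)); last first.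
  move=> u v Pu Pv /ffunP huv; apply: val_inj.
  apply: (@eq_from_nth _ false) => [|t]; rewrite !size_tuple // => tm.
  have [|] := boolP ((t < a)%N || (m - b <= t)%N); first exact: hP.
  rewrite negb_or -leqNgt -ltnNge => /andP[at_ tb].
  have ti : (t - a < m - (a + b))%N by lia.
  by have := huv (Ordinal ti); rewrite !ffunE /= subnKC.
by apply: leq_trans (max_card _) _; rewrite card_ffun card_bool card_ord.
Qed.

Section family.
Context (m k : nat).
Implicit Types u : m.-tuple bool.

(** Second string, before reversal, of a cell of [windows]: complementing outside [[s, s + k)] makes
    the two strings agree exactly on that window. *)
Definition flip s u : m.-tuple bool :=
  [tuple nth false u t (+) ~~ (s <= t < s + k)%N | t < m].

Lemma nth_flip s u t : (t < m)%N ->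
  nth false (flip s u) t = nth false u t (+) ~~ (s <= t < s + k)%N.
Proof.
by move=> tm; rewrite -[t]/(nat_of_ord (Ordinal tm)) -tnth_nth tnth_mktuple.
Qed.

Lemma card_diagonal (p q : seq bool) :
  (#|[pred u : m.-tuple bool | prefix p u && prefix q (rev u)]|
     <= 2 ^ (m - (size p + size q)))%N.
Proof.
apply: card_free_bits => u v /andP[pu qu] /andP[pv qv] t tm /orP[tp|tq].
  by rewrite (prefix_nth pu) // (prefix_nth pv).
by rewrite (prefix_rev_nth qu) ?(prefix_rev_nth qv) ?size_tuple.
Qed.

Lemma card_flip s (p q : seq bool) :
  (#|[pred u : m.-tuple bool | prefix p u && prefix q (rev (flip s u))]|
     <= 2 ^ (m - (size p + size q)))%N.
Proof.
apply: card_free_bits => u v /andP[pu qu] /andP[pv qv] t tm /orP[tp|tq].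
  by rewrite (prefix_nth pu) // (prefix_nth pv).
(* The mask depends on [t] alone, so prescribing a digit of [flip s u] prescribes that digit of
   [u]. *)
apply: (can_inj (addbK (~~ (s <= t < s + k)%N))).
by rewrite -!nth_flip // (prefix_rev_nth qu) ?(prefix_rev_nth qv) ?size_tuple.
Qed.

Lemma card_ord_between N lo hi (P : pred 'I_N) :
  (forall s, P s -> (lo <= s <= hi)%N) -> (#|P| <= hi.+1 - lo)%N.
Proof.
move=> h; rewrite cardE -(size_map (@nat_of_ord N)) -(size_iota lo (hi.+1 - lo)).
apply: uniq_leq_size => [|i]; first by rewrite map_inj_uniq ?enum_uniq //; exact: val_inj.
move=> /mapP[s]; rewrite mem_enum => /h /andP[h1 h2] ->.
by rewrite mem_iota h1 /= subnKC ?ltnS // (leq_trans h1) // ltnW.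
Qed.

(* On a rectangle meeting the diagonal family the prescribed bits of [u] and of
   [flip s u] agree where they overlap, so the overlap lies in the window. *)
Lemma flip_window s u u0 (p q : seq bool) :
  prefix p u -> prefix q (rev (flip s u)) -> prefix p u0 -> prefix q (rev u0) ->
  (size p <= m)%N -> (size q <= m)%N ->
  (m < size p + size q)%N -> (s <= m - size q)%N && (size p <= s + k)%N.
Proof.
move=> pu qu pu0 qu0 pm qm mpq.
have win t : (t < size p)%N -> (m - size q <= t)%N -> (s <= t < s + k)%N.
  move=> tp tq; have tm : (t < m)%N by lia.
  have := nth_flip s u tm; rewrite (prefix_nth pu) // -(prefix_nth pu0) //.
  rewrite (prefix_rev_nth qu) ?(prefix_rev_nth qu0) ?size_tuple //.
  by case: nth; case: (s <= t < s + k)%N.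
(* The first and the last overlapping positions are [m - size q] and [size p - 1]. *)
have /andP[h _] : (s <= m - size q < s + k)%N by apply: win => //; lia.
have /andP[_ h'] : (s <= (size p).-1 < s + k)%N by apply: win => //; lia.
by rewrite h; lia.
Qed.

(** Each window contributes at most [2^(m - (size p + size q))] strings. With an overlap of length
    [j], only windows containing it contribute, at most [4^(k - j)] of them; truncated subtraction
    gives [j = 0] when there is no overlap. *)
Lemma card_flips N (p q : seq bool) : N = (4 ^ k)%N ->
  (exists u0 : m.-tuple bool, prefix p u0 && prefix q (rev u0)) ->
  (size p <= m)%N -> (size q <= m)%N ->
  (#|[pred i : 'I_N * m.-tuple bool |
       prefix p i.2 && prefix q (rev (flip i.1 i.2))]|
     * 4 ^ (size p + size q - m) <= 4 ^ k * 2 ^ (m - (size p + size q)))%N.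
Proof.
move=> Nk [u0 /andP[pu0 qu0]] pm qm.
pose A s := [pred u : m.-tuple bool | prefix p u && prefix q (rev (flip s u))].
pose S := [pred s : 'I_N | [exists u, A s u]].
have le1 : (#|[pred i : 'I_N * m.-tuple bool | A i.1 i.2]| <=
    #|S| * 2 ^ (m - (size p + size q)))%N.
  have -> : #|[pred i : 'I_N * m.-tuple bool | A i.1 i.2]| =
      (\sum_(s < N) \sum_(u | A s u) 1)%N.
    by rewrite pair_big_dep -sum1_card; apply: eq_bigl.
  rewrite -sum_nat_const [X in (_ <= X)%N]big_mkcond /=; apply: leq_sum => s _.
  rewrite sum1_card; case: ifPn => [_|]; first exact: card_flip.
  rewrite inE negb_exists => /forallP h.
  by rewrite eq_card0 // => u; apply/negbTE; exact: (h u).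
apply: leq_trans (leq_mul le1 (leqnn _)) _.
rewrite mulnAC leq_mul2r; apply/orP; right.
have [mpq|mpq] := leqP (size p + size q) m.
  have -> : (size p + size q - m = 0)%N by lia.
  by rewrite muln1 (leq_trans (max_card _)) // card_ord Nk.
have hS s : S s -> (size p - k <= s <= m - size q)%N && (size p + size q - m <= k)%N.
  move=> /existsP[u /andP[pu qu]].
  by have /andP[h1 h2] := flip_window pu qu pu0 qu0 pm qm mpq; lia.
have [/pred0P/eq_card0 ->|/pred0Pn[s0 /hS /andP[_ jk]]] := boolP (pred0b S).
  by rewrite mul0n.
have cS : (#|S| <= (m - size q).+1 - (size p - k))%N.
  by apply: card_ord_between => s /hS /andP[].
rewrite -[X in (_ <= 4 ^ X)%N](subnK jk) expnD leq_mul2r; apply/orP; right.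
(* At most [k - j + 1] starting points remain, and [n + 1 <= 4^n]. *)
apply: leq_trans cS _; apply: leq_trans (_ : (k - (size p + size q - m)).+1 <= _)%N.
  by lia.
exact: ltn_expl.
Qed.

End family.

(** * Summation over a sparse family *)

Section sparse_sums.
Context {R : realType}.
Local Notation plane := (measurableTypeR R * measurableTypeR R)%type.

(** A dyadic interval meeting the unit interval is contained in it or is some [[0, 2^n)]. *)
Lemma interval_sub_pos_level (I : dyadic_interval) (x : R) :
  interval_set (0, 0) x -> interval_set I x ->
  (interval_set I : set R) `<=` interval_set ((pos_level I)%:Z, 0).
Proof.
move=> x01 xI; case: (lerP 0 I.1) => n0.
  have -> : (pos_level I)%:Z = I.1 by rewrite /pos_level; lia.
  by rewrite -(unit_ge0 n0 x01 xI).
have -> : (pos_level I)%:Z = 0 by rewrite /pos_level; lia.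
have [s _ ->] := unit_code_le0 (ltW n0) x01 xI.
by move=> y; rewrite -code_nil; apply: code_prefix_sub; exact: prefix0s.
Qed.

(* The squared relative size of the unit interval in a dyadic interval of level
   [n], times the loss [n + 1] in the logarithm of the Orlicz average. *)
Definition weight (n : nat) : R := 4^-1 ^+ n * n.+1%:R.

Lemma weight_ge0 n : 0 <= weight n.
Proof. by rewrite mulr_ge0 ?exprn_ge0. Qed.

Lemma sum_weight_le L : \sum_(n < L) weight n * 2 ^+ n <= 4.
Proof.
(* The terms are [(n + 1) 2^-n], with this exact partial sum. *)
suff -> : \sum_(n < L) weight n * 2 ^+ n = 4 - (2 * L%:R + 4) * 2^-1 ^+ L.
  by rewrite lerBlDr lerDl mulr_ge0 ?exprn_ge0 // addr_ge0 // mulr_ge0.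
elim: L => [|L IH]; first by rewrite big_ord0 mulr0 add0r expr0 mulr1 subrr.
rewrite big_ord_recr /= IH /weight mulrAC -exprMn.
have -> : 4^-1 * 2 = 2^-1 :> R by field.
by rewrite exprS -natr1; field.
Qed.

Definition meets_unit (Q : dyadic_rectangle) : Prop :=
  exists z : R * R, rect (cell [::] [::]) z /\ rect Q z.

(** Classes of rectangles sharing one hull [[0, 2^A) x [0, 2^B)], in which their disjoint sets [E Q]
    have total area at most [2^(A + B)]. *)
Definition pos_class (A B : nat) (Q : dyadic_rectangle) : bool :=
  [&& `[< meets_unit Q >], pos_level Q.1 == A & pos_level Q.2 == B].

Lemma rect_sub_pos_class A B Q : pos_class A B Q ->
  (rect Q : set (R * R)) `<=` rect ((A%:Z, 0), (B%:Z, 0)).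
Proof.
move=> /and3P[/asboolP[z [[u1 u2] [z1 z2]]] /eqP <- /eqP <-] w [w1 w2]; split.
  exact: (interval_sub_pos_level u1 z1).
exact: (interval_sub_pos_level u2 z2).
Qed.

Lemma sum_pos_class_le (X : set dyadic_rectangle)
    (E : dyadic_rectangle -> set plane) A B :
  finite_set X -> trivIset X E ->
  (forall Q, X Q -> measurable (E Q) /\ E Q `<=` rect Q) ->
  (\sum_(Q \in X `&` pos_class A B) leb2 R (E Q) <= (2 ^+ A * 2 ^+ B)%:E)%E.
Proof.
move=> fX tX hE; rewrite -measure_fin_bigcup; last first.
- by move=> Q [/hE[]].
- by apply: sub_trivIset tX => Q [].
- exact: finite_setIl.
have -> : (2 ^+ A * 2 ^+ B)%:E = leb2 R (rect ((A%:Z, 0), (B%:Z, 0))).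
  by rewrite leb2_rect.
have mU : measurable (\bigcup_(Q in X `&` pos_class A B) E Q).
  by apply: fin_bigcup_measurable => [|Q [/hE[]]] //; exact: finite_setIl.
have mr := measurable_rect ((A%:Z, 0), (B%:Z, 0)).
apply: le_measure; [exact: mem_set|exact: mem_set|].
by apply: bigcup_sub => Q [/hE[_ h] /rect_sub_pos_class h'] z /h /h'.
Qed.

(** Sparseness replaces the area of [Q] by that of [E Q] over [eta]. In the class of levels [A], [B]
    these areas sum to at most [2^(A + B)], and each of the two sums of [weight n * 2^n] is at most
    4, whence 16. *)
Lemma sparse_sum_le (eta K : R) (S : set dyadic_rectangle)
    (a : dyadic_rectangle -> \bar R) :
  0 < eta -> 0 <= K -> sparse eta S ->
  (forall Q, (0 <= a Q)%E) ->
  (forall Q, ~ meets_unit Q -> a Q = 0%E) ->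
  (forall Q, meets_unit Q ->
    (a Q <= (K * (weight (pos_level Q.1) * weight (pos_level Q.2)))%:E)%E) ->
  (\esum_(Q in S) (a Q * (area R Q)%:E) <= (16 * K / eta)%:E)%E.
Proof.
move=> eta0 K0 [E [hE tE]] a0 aN aK.
apply: ub_ereal_sup => _ [X [fX XS] <-].
pose v A B := (K / eta * (weight A * weight B))%:E.
have v0 A B : (0 <= v A B)%E.
  by rewrite lee_fin !mulr_ge0 ?weight_ge0 // invr_ge0 ltW.
have term Q : X Q -> meets_unit Q ->
    (a Q * (area R Q)%:E <= v (pos_level Q.1) (pos_level Q.2) * leb2 R (E Q))%E.
  move=> XQ mQ; have [_ _ h] := hE _ (XS _ XQ).
  have aQ : (area R Q)%:E = leb2 R (rect Q) by rewrite areaE leb2_rect.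
  apply: le_trans (lee_wpmul2r _ (aK _ mQ)) _; first by rewrite lee_fin ltW ?area_gt0.
  have -> : v (pos_level Q.1) (pos_level Q.2) =
      ((K * (weight (pos_level Q.1) * weight (pos_level Q.2)))%:E * (eta^-1)%:E)%E.
    by rewrite -EFinM /v mulrAC.
  rewrite -muleA; apply: lee_wpmul2l.
    by rewrite lee_fin !mulr_ge0 ?weight_ge0.
  rewrite -(@lee_pmul2l _ eta%:E) // [leRHS]muleA
    -[(eta%:E * _^-1%:E)%E]EFinM divff ?gt_eqF // mul1e.
  by rewrite aQ.
(* A bound for the levels occurring in the finite family [X], so that finitely many classes
   suffice. *)
pose L := (\max_(Q <- fset_set X) maxn (pos_level Q.1) (pos_level Q.2)).+1.
have XL Q : X Q -> (pos_level Q.1 < L)%N /\ (pos_level Q.2 < L)%N.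
  move=> XQ; have : (maxn (pos_level Q.1) (pos_level Q.2) < L)%N.
    rewrite ltnS.
    apply: (@leq_bigmax_seq _ _ xpredT
      (fun Q : dyadic_rectangle => maxn (pos_level Q.1) (pos_level Q.2))) => //.
    by rewrite in_fset_set // mem_set.
  by rewrite gtn_max => /andP[].
(* Only the pair [A], [B] of the levels of [Q] contributes to this double sum; spreading the term
   over all pairs allows the sums to be exchanged. *)
have split_term Q : X Q -> (a Q * (area R Q)%:E <=
    \sum_(A < L) \sum_(B < L)
      (if pos_class A B Q then v A B * leb2 R (E Q) else 0))%E.
  move=> XQ; have nn (A B : nat) :
      (0 <= if pos_class A B Q then v A B * leb2 R (E Q) else 0)%E.
    by case: ifP => // _; rewrite mule_ge0.
  have [mQ|mQ] := pselect (meets_unit Q); last first.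
    by rewrite aN // mul0e; do 2!apply: sume_ge0 => ? _.
  have [L1 L2] := XL _ XQ.
  rewrite (bigD1 (Ordinal L1)) //= (bigD1 (Ordinal L2)) //=.
  rewrite {1}/pos_class !eqxx asboolT //= -addeA; apply: le_trans (term _ XQ mQ) _.
  by rewrite leeDl // adde_ge0 //; do ?[apply: sume_ge0 => ? _].
rewrite fsbig_finite //=.
apply: (@le_trans _ _ (\sum_(Q <- fset_set X) \sum_(A < L) \sum_(B < L)
      (if pos_class A B Q then v A B * leb2 R (E Q) else 0))%E).
  rewrite big_seq [leRHS]big_seq; apply: lee_sum => Q.
  by rewrite in_fset_set // => /set_mem; exact: split_term.
rewrite exchange_big /=.
apply: (@le_trans _ _ (\sum_(A < L) \sum_(B < L) (v A B * (2 ^+ A * 2 ^+ B)%:E))%E).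
  apply: lee_sum => A _; rewrite exchange_big /=; apply: lee_sum => B _.
  rewrite -big_mkcond /= -ge0_sume_distrr //.
  apply: lee_wpmul2l => //.
  have := sum_pos_class_le A B fX (sub_trivIset XS tE)
    (fun Q XQ => let: And3 h1 h2 _ := hE Q (XS Q XQ) in conj h1 h2).
  rewrite fsbig_mkcondr fsbig_finite //=; apply: le_trans.
  rewrite big_mkcond /= le_eqVlt; apply/orP; left; apply/eqP.
  apply: eq_bigr => Q _; congr (if _ then _ else _).
  by apply/idP/idP => [?|/set_mem //]; exact: mem_set.
under eq_bigr do (under eq_bigr do rewrite -EFinM; rewrite sumEFin).
rewrite sumEFin lee_fin.
have -> : \sum_(A < L) \sum_(B < L) (K / eta * (weight A * weight B)) * (2 ^+ A * 2 ^+ B)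
  = (K / eta) * ((\sum_(A < L) weight A * 2 ^+ A) * (\sum_(B < L) weight B * 2 ^+ B)).
  rewrite mulr_suml mulr_sumr; apply: eq_bigr => A _.
  rewrite mulr_sumr mulr_sumr; apply: eq_bigr => B _.
  by ring.
have -> : 16 * K / eta = K / eta * 16 by ring.
apply: ler_wpM2l.
  by rewrite mulr_ge0 // invr_ge0 ltW.
have s0 : 0 <= \sum_(A < L) weight A * 2 ^+ A.
  by apply: sumr_ge0 => A _; rewrite mulr_ge0 ?weight_ge0 ?exprn_ge0.
have -> : 16 = 4 * 4 :> R by rewrite -natrM.
by apply: ler_pM => //; exact: sum_weight_le.
Qed.

End sparse_sums.

(** * Orlicz averages of bounded functions *)

Section orlicz.
Context {R : realType}.
Local Notation plane := (measurableTypeR R * measurableTypeR R)%type.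

Lemma measurable_xlog_pow (alpha : R) : measurable_fun setT (xlog_pow alpha).
Proof.
apply: measurable_funM; first exact: measurable_id.
apply: (measurableT_comp (measurable_powR alpha)).
apply: (measurableT_comp (@measurable_ln R)).
exact: measurable_funD.
Qed.

Lemma ln_expR1_ge1 (x : R) : 0 <= x -> 1 <= ln (expR 1 + x).
Proof.
move=> x0; rewrite -[leLHS](@expRK R) ler_ln ?lerDl //.
  by rewrite posrE expR_gt0.
by rewrite posrE ltr_wpDr // expR_gt0.
Qed.

Lemma xlog_pow_le (alpha x y : R) : 0 <= alpha -> 0 <= x -> x <= y ->
  xlog_pow alpha x <= x * ln (expR 1 + y) `^ alpha.
Proof.
move=> a0 x0 xy; have y0 := le_trans x0 xy; rewrite /xlog_pow ler_wpM2l //.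
have l1 (z : R) : 0 <= z -> 0 <= ln (expR 1 + z).
  by move=> z0; rewrite (le_trans _ (ln_expR1_ge1 z0)).
by rewrite ge0_ler_powR ?nnegrE ?l1 // ler_ln ?lerD2l // posrE ltr_wpDr // expR_gt0.
Qed.

Lemma xlog_pow_ge0 (alpha x : R) : 0 <= x -> 0 <= xlog_pow alpha x.
Proof. by move=> x0; rewrite mulr_ge0 ?powR_ge0. Qed.

Lemma avg_ge0 (h : R * R -> R) Q : (forall z, 0 <= h z) -> (0 <= avg h Q)%E.
Proof.
move=> h0; apply: mule_ge0; first by rewrite lee_fin invr_ge0 ltW // area_gt0.
by apply: integral_ge0 => z _; rewrite lee_fin.
Qed.

Lemma orlicz_avg_ge0 phi (h : R * R -> R) Q : (0 <= orlicz_avg phi h Q)%E.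
Proof. by apply: le_ereal_inf_tmp => _ [l [l0 _] <-]; rewrite lee_fin ltW. Qed.

(** As [xlog_pow] vanishes at 0, every positive [l] is admissible and the infimum is 0. *)
Lemma orlicz_avg_eq0 alpha (h : R * R -> R) Q :
  (forall z, rect Q z -> h z = 0) -> orlicz_avg (xlog_pow alpha) h Q = 0%E.
Proof.
move=> hQ; apply/eqP; rewrite eq_le orlicz_avg_ge0 andbT.
apply/lee_addgt0Pr => e e0; rewrite add0e; apply: ereal_inf_lbound.
exists e => //; split=> //; rewrite /avg integral0_eq ?mule0 // => z Qz.
by rewrite hQ // mul0r /xlog_pow mul0r.
Qed.

Lemma orlicz_avg_le (alpha M D l : R) (h : R * R -> R) Q :
  0 <= alpha -> 0 < l -> (forall z, 0 <= h z <= M) ->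
  measurable_fun setT (h : plane -> R) ->
  (avg h Q <= D%:E)%E -> D * ln (expR 1 + M / l) `^ alpha <= l ->
  (orlicz_avg (xlog_pow alpha) h Q <= l%:E)%E.
Proof.
move=> a0 l0 hM mh hD Dl; apply: ereal_inf_lbound; exists l => //; split=> //.
set L := _ `^ _ in Dl; have mR := measurable_rect Q.
have mhQ : measurable_fun (rect Q : set plane) (h : plane -> R).
  exact: measurable_funTS.
have L0 : 0 <= L by exact: powR_ge0.
apply: (@le_trans _ _ ((L / l)%:E * avg h Q)%E); last first.
  apply: le_trans (lee_wpmul2l _ hD) _; first by rewrite lee_fin divr_ge0 // ltW.
  by rewrite -EFinM lee_fin mulrAC ler_pdivrMr // mul1r mulrC.
rewrite /avg muleCA; apply: lee_wpmul2l; first by rewrite lee_fin invr_ge0 ltW ?area_gt0.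
rewrite -ge0_integralZl //; last 3 first.
- exact/measurable_EFinP.
- by move=> z _; rewrite lee_fin; have /andP[] := hM z.
- by rewrite lee_fin divr_ge0 // ltW.
apply: ge0_le_integral => //.
- move=> z _; have /andP[h0 _] := hM z.
  by rewrite lee_fin xlog_pow_ge0 // divr_ge0 // ltW.
- apply/measurable_EFinP.
  apply: (measurableT_comp (measurable_xlog_pow alpha)).
  by apply: measurable_funM => //; exact: measurable_cst.
- apply/measurable_EFinP.
  by apply: measurable_funM => //; exact: measurable_cst.
move=> z _; have /andP[h0 h1] := hM z; rewrite -EFinM lee_fin.
apply: le_trans (xlog_pow_le (y := M / l) a0 _ _) _.
- by rewrite divr_ge0 // ltW.
- by rewrite ler_wpM2r // invr_ge0 ltW.
by rewrite -/L (_ : _ * L = L / l * h z) //; ring.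
Qed.

(** From [e >= 2] follows [e + 2^n <= e^(n + 2)]. *)
Lemma ln_pow2_le n : ln (expR 1 + 2 ^+ n) <= n.+2%:R :> R.
Proof.
have e2 : 2 <= expR 1 :> R by apply: le_trans (expR_ge1Dx _); lra.
have h : 1 <= (2 : R) ^+ n by rewrite exprn_ege1 // ler1n.
have p0 : 0 < expR 1 + (2 : R) ^+ n by rewrite addr_gt0 ?expR_gt0 // exprn_gt0.
rewrite -[leRHS](@expRK R) ler_ln ?posrE ?expR_gt0 //.
rewrite -[n.+2%:R]mulr1 expRM_natl.
have h2 : (2 : R) ^+ n <= expR 1 ^+ n by rewrite lerXn2r // nnegrE // expR_ge0.
rewrite !exprS; move: (expR 1) (expR 1 ^+ n) (2 ^+ n) e2 h h2 => e u v e2 v1 vu.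
have h1 : e + v <= 2 * (e * v) by nra.
have h2 : e * v <= e * u by nra.
by nra.
Qed.

End orlicz.

(** * The two test functions and their averages *)

Lemma prefix_eq (p q : seq bool) : size p = size q -> prefix p q -> p = q.
Proof. by move=> e; rewrite prefixE e take_size => /eqP. Qed.

(** The last of the [4^k] windows of length [k], starting at [4^k - 1], ends exactly at this
    depth. *)
Definition depth (k : nat) : nat := (4 ^ k + k).-1.

Lemma depthE k : (depth k).+1 = (4 ^ k + k)%N.
Proof. by rewrite /depth prednK // addn_gt0 expn_gt0. Qed.

Section counterexample.
Context {R : realType}.
Local Notation plane := (measurableTypeR R * measurableTypeR R)%type.

(** Distinct strings of length [m] have disjoint intervals, so injectivity of [x] leaves at most one
    nonzero term. *)
Lemma step_le (K : finType) m (c : R) (x y : K -> m.-tuple bool) z : 0 <= c ->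
  injective x -> step c x y z <= c.
Proof.
move=> c0 xI; have [z0|/step_neq0[i [zi _]]] := eqVneq (step c x y z) 0.
  by rewrite z0.
rewrite /step (bigD1 i) //= big1 ?addr0 => [|j ji].
  by rewrite -[leRHS]mulr1 ler_wpM2l // indicE; case: (_ \in _).
rewrite indicE memNset ?mulr0 // => -[zj _]; case/eqP: ji; apply/xI/val_inj.
apply: prefix_eq; first by rewrite !size_tuple.
by apply: code_meet_prefix zj zi; rewrite !size_tuple.
Qed.

Context (k : nat).
Local Notation m := (depth k).

(** [diag] and [windows] are the densities [f] and [g]; the heights give both of them integral 1. *)
Definition diag : R * R -> R :=
  step (2 ^+ m) (fun u : m.-tuple bool => u) (fun u => [tuple of rev u]).

Definition windows : R * R -> R :=
  step (2 ^+ m / 4 ^+ k) (fun i : 'I_(4 ^ k) * m.-tuple bool => i.2)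
    (fun i => [tuple of rev (flip k i.1 i.2)]).

Lemma diag_ge0 z : 0 <= diag z. Proof. exact/step_ge0/exprn_ge0. Qed.

Lemma diag_le z : diag z <= 2 ^+ m.
Proof. by apply: step_le => //; exact: exprn_ge0. Qed.

Lemma windows_ge0 z : 0 <= windows z.
Proof. by apply: step_ge0; rewrite divr_ge0 ?exprn_ge0. Qed.

(** For a rectangle meeting the unit square, the fraction of its hull [[0, 2^A) x [0, 2^B)] that
    this square fills. *)
Definition rect_scale (Q : dyadic_rectangle) : R :=
  2^-1 ^+ pos_level Q.1 * 2^-1 ^+ pos_level Q.2.

Lemma rect_scale_gt0 Q : 0 < rect_scale Q.
Proof. by rewrite mulr_gt0 // exprn_gt0. Qed.

Lemma pow_truncated a b :
  (2 : R) ^+ (a + b) * 2 ^+ (m - (a + b)) = 2 ^+ m * 2 ^+ (a + b - m).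
Proof. by rewrite -!exprD; congr (_ ^+ _); lia. Qed.

Lemma avg_diag_le Q p q : truncates (R := R) m Q.1 p -> truncates (R := R) m Q.2 q ->
  (avg diag Q <= (rect_scale Q * 2 ^+ (size p + size q - m))%:E)%E.
Proof.
move=> hp hq; apply: le_trans (avg_step_le _ _ _ hp hq) _; first exact: exprn_ge0.
rewrite lee_fin -/(rect_scale Q); have := @card_diagonal m p q.
set n := #|_| => hn; have {hn} : (n%:R : R) <= 2 ^+ (m - (size p + size q)).
  by rewrite -natrX ler_nat.
have := pow_truncated (size p) (size q); have := rect_scale_gt0 Q.
rewrite [_ ^+ (m + m)]exprD exprVn; have : 0 < (2 : R) ^+ m by rewrite exprn_gt0.
have : 0 < (2 : R) ^+ (size p + size q) by rewrite exprn_gt0.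
move: (2 ^+ m) (2 ^+ (_ + _)) (2 ^+ (m - _)) (2 ^+ (_ - m)) (rect_scale Q) (n%:R).
move=> P X T J th c X0 P0 th0 e cT.
have -> : P * th * (X * (P^-1 * P^-1)) * c = (th / P) * (X * c).
  by field; rewrite gt_eqF.
have -> : th * J = th / P * (X * T) by rewrite e; field; rewrite gt_eqF.
apply: ler_wpM2l; first by rewrite divr_ge0 // ltW.
by rewrite ler_pM2l.
Qed.

(** The string [u] makes [Q] compatible with a diagonal cell, so [card_flips] applies: its saving
    [4^-j] outweighs the concentration factor [2^j] and leaves [2^-j]. *)
Lemma avg_windows_le Q p q : truncates (R := R) m Q.1 p -> truncates (R := R) m Q.2 q ->
  (exists u : m.-tuple bool, prefix p u && prefix q (rev u)) ->
  (avg windows Q <= (rect_scale Q / 2 ^+ (size p + size q - m))%:E)%E.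
Proof.
move=> hp hq hu; apply: le_trans (avg_step_le _ _ _ hp hq) _.
  by rewrite divr_ge0 ?exprn_ge0.
rewrite lee_fin -/(rect_scale Q).
have pm : (size p <= m)%N by rewrite hp.1 geq_minr.
have qm : (size q <= m)%N by rewrite hq.1 geq_minr.
have := card_flips (erefl (4 ^ k)%N) hu pm qm.
set n := #|_|; rewrite -(ler_nat R) !natrM !natrX.
have -> : 4 = 2 ^+ 2 :> R by rewrite -natrX.
rewrite exprAC.
have := pow_truncated (size p) (size q); have := rect_scale_gt0 Q.
rewrite [_ ^+ (m + m)]exprD exprVn; have : 0 < (2 : R) ^+ m by rewrite exprn_gt0.
have : 0 < (2 : R) ^+ (size p + size q) by rewrite exprn_gt0.
have : 0 < (2 : R) ^+ (size p + size q - m) by rewrite exprn_gt0.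
have : 0 < (2 : R) ^+ 2 ^+ k by rewrite !exprn_gt0.
move: (2 ^+ 2 ^+ k) (2 ^+ m) (2 ^+ (_ - m)) (2 ^+ (_ + _)) (2 ^+ (m - _))
  (rect_scale Q) (n%:R).
move=> F P J X T th c F0 J0 X0 P0 th0 e cT.
(* Multiplying by [J] a second time produces [J^2 = 4^j], the factor in [card_flips]. *)
rewrite ler_pdivlMr // -(ler_pM2r J0).
have -> : P / F * th * (X * (P^-1 * P^-1)) * c * J * J = (th / P) * (X * (c * J ^+ 2) / F).
  by field; rewrite !gt_eqF.
have -> : th * J = th / P * (X * T) by rewrite e; field; rewrite gt_eqF.
apply: ler_wpM2l; first by rewrite divr_ge0 // ltW.
rewrite ler_pdivrMr // -mulrA ler_pM2l //.
by rewrite [T * _]mulrC.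
Qed.

End counterexample.

(** * Upper bound for sparse forms *)

Section sparse_bound.
Context {R : realType} (k : nat).
Local Notation m := (depth k).
Local Notation plane := (measurableTypeR R * measurableTypeR R)%type.

Lemma normr_diag : (fun z => `|diag k z|) = diag k :> (R * R -> R).
Proof. by apply/funext => z; rewrite ger0_norm // diag_ge0. Qed.

Lemma normr_windows : (fun z => `|windows k z|) = windows k :> (R * R -> R).
Proof. by apply/funext => z; rewrite ger0_norm // windows_ge0. Qed.

Lemma powR_le_self (alpha : R) n :
  0 <= alpha -> alpha <= 1 -> n.+1%:R `^ alpha <= n.+1%:R :> R.
Proof.
by move=> a0 a1; rewrite -[leRHS]powRr1 // ler_powR // ler1n.
Qed.

(** The logarithm is at most [m + A + B + 2 <= (m + 2)(A + 1)(B + 1)]. The power [alpha <= 1] is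
    kept on [m + 2] only; the other factors go into [weight]. *)
Lemma log_pow_level_le (alpha : R) A B l : 0 <= alpha -> alpha <= 1 ->
  2^-1 ^+ A * 2^-1 ^+ B <= l ->
  ln (expR 1 + 2 ^+ m / l) `^ alpha <=
    m.+2%:R `^ alpha * (A.+1%:R * B.+1%:R) :> R.
Proof.
move=> a0 a1 hl; have l0 : 0 < l by apply: lt_le_trans hl; rewrite mulr_gt0 // exprn_gt0.
have h1 : 2 ^+ m / l <= 2 ^+ (m + A + B).
  rewrite ler_pdivrMr //; apply: le_trans (ler_wpM2l _ hl); last exact: exprn_ge0.
  by rewrite !exprD !exprVn le_eqVlt; apply/orP; left; apply/eqP; field;
    rewrite !expf_neq0.
have p0 : 0 <= 2 ^+ m / l by rewrite divr_ge0 ?exprn_ge0 // ltW.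
have h2 : ln (expR 1 + 2 ^+ m / l) <= m.+2%:R * (A.+1%:R * B.+1%:R).
  apply: le_trans (_ : _ <= ln (expR 1 + 2 ^+ (m + A + B))) _.
    have e0 (x : R) : 0 <= x -> expR 1 + x \is Num.pos.
      by move=> x0; rewrite posrE ltr_pwDl ?expR_gt0.
    by rewrite ler_ln ?e0 ?lerD2l // exprn_ge0.
  apply: le_trans (ln_pow2_le _) _.
  by rewrite -!natrM ler_nat; nia.
apply: le_trans (_ : (m.+2%:R * (A.+1%:R * B.+1%:R)) `^ alpha <= _).
  rewrite ge0_ler_powR ?nnegrE ?mulr_ge0 //.
  by rewrite (le_trans _ (ln_expR1_ge1 p0)).
rewrite !powRM ?mulr_ge0 // ler_wpM2l ?powR_ge0 //.
by rewrite ler_pM ?powR_ge0 ?powR_le_self.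
Qed.

Lemma diag_unit z : diag k z != 0 :> R -> rect (cell [::] [::]) z.
Proof. by move=> /step_neq0[i]; exact: cell_unit. Qed.

Lemma sparse_term_eq0 (alpha : R) Q : (forall z, rect Q z -> diag k z = 0 :> R) ->
  (orlicz_avg (xlog_pow alpha) (diag (R := R) k) Q * avg (windows k) Q)%E = 0%E.
Proof. by move=> h; rewrite orlicz_avg_eq0 // mul0e. Qed.

(** The factors [2^j] and [2^-j] of the two averages cancel. The remaining square of [rect_scale]
    and the level factors of the logarithm are exactly the two weights. *)
Lemma sparse_term_le (alpha : R) Q : 0 <= alpha -> alpha <= 1 ->
  (orlicz_avg (xlog_pow alpha) (diag k) Q * avg (windows k) Q <=
   (m.+2%:R `^ alpha * (weight (pos_level Q.1) * weight (pos_level Q.2)))%:E)%E.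
Proof.
move=> a0 a1; have [dz|nz] := pselect (forall z, rect Q z -> diag k z = 0 :> R).
  by rewrite sparse_term_eq0 // lee_fin !mulr_ge0 ?weight_ge0 ?powR_ge0.
have [p hp] := truncation_exists (R := R) m Q.1.
have [q hq] := truncation_exists (R := R) m Q.2.
have hu : exists u : m.-tuple bool, prefix p u && prefix q (rev u).
  apply: contrapT => hu; apply: nz => z Qz; apply/eqP/negPn/negP => dz.
  by apply: hu; have [u hu] := truncates_step hp hq Qz dz; exists u.
set A := pos_level Q.1; set B := pos_level Q.2.
pose J : R := 2 ^+ (size p + size q - m).
have J1 : 1 <= J by rewrite exprn_ege1 // ler1n.
have J0 : 0 < J by apply: lt_le_trans J1.
have th0 := rect_scale_gt0 (R := R) Q.
pose L : R := m.+2%:R `^ alpha * (A.+1%:R * B.+1%:R).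
have m1 : 1 <= m.+2%:R `^ alpha :> R.
  by rewrite -[leLHS](powRr0 m.+2%:R) ler_powR // ler1n.
have L1 : 1 <= L.
  by rewrite !mulr_ege1 // ler1n.
have l0 : 0 < rect_scale Q * J * L.
  by rewrite !mulr_gt0 //; apply: lt_le_trans L1.
have ho : (orlicz_avg (xlog_pow alpha) (diag k) Q <= (rect_scale Q * J * L)%:E)%E.
  apply: (@orlicz_avg_le _ alpha (2 ^+ m) (rect_scale Q * J)) => //.
  - by move=> z; rewrite diag_ge0 diag_le.
  - exact: step_measurable.
  - exact: avg_diag_le hp hq.
  rewrite ler_pM2l ?mulr_gt0 //; apply: log_pow_level_le => //.
  rewrite -/(rect_scale Q) -mulrA ler_peMr //; first exact: ltW.
  exact: mulr_ege1.
apply: le_trans (lee_pmul (orlicz_avg_ge0 _ _ _) _ ho (avg_windows_le hp hq hu)) _.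
  exact/avg_ge0/windows_ge0.
rewrite -EFinM lee_fin -/J le_eqVlt; apply/orP; left; apply/eqP.
rewrite /L /weight /rect_scale -/A -/B.
have -> : 4^-1 = 2^-1 * 2^-1 :> R by rewrite -invfM -natrM.
rewrite !exprMn; field; exact: lt0r_neq0.
Qed.

Lemma sparse_form_le (alpha eta : R) S : 0 <= alpha -> alpha <= 1 -> 0 < eta ->
  sparse eta S ->
  (sparse_form (xlog_pow alpha) S (diag k) (windows k) <=
   (16 * m.+2%:R `^ alpha / eta)%:E)%E.
Proof.
move=> a0 a1 e0 sS; rewrite /sparse_form normr_diag normr_windows.
apply: (sparse_sum_le (a := fun Q =>
  orlicz_avg (xlog_pow alpha) (diag k) Q * avg (windows k) Q)%E) => //.
- by move=> Q; rewrite mule_ge0 ?orlicz_avg_ge0 //; exact/avg_ge0/windows_ge0.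
- move=> Q nQ; apply: sparse_term_eq0 => z Qz; apply/eqP/negPn/negP => /diag_unit zu.
  by apply: nQ; exists z.
- by move=> Q _; exact: sparse_term_le.
Qed.

End sparse_bound.

(** * Lower bound for the maximal function *)

Lemma prefix_take_nth m (u v : m.-tuple bool) a :
  (forall t, (t < a)%N -> (t < m)%N -> nth false u t = nth false v t) ->
  prefix (take a u) v.
Proof.
move=> h; have -> : take a u = take a v; last exact: prefix_take.
apply: (@eq_from_nth _ false) => [|t]; rewrite !size_take_min !size_tuple //.
by rewrite leq_min => /andP[ta tm]; rewrite !nth_take // h.
Qed.

Lemma prefix_rev_drop_nth m (u v : m.-tuple bool) s :
  (forall t, (s <= t)%N -> (t < m)%N -> nth false u t = nth false v t) ->
  prefix (rev (drop s u)) (rev v).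
Proof.
move=> h; have -> : drop s u = drop s v.
  apply: (@eq_from_nth _ false) => [|t]; rewrite !size_drop !size_tuple // => tm.
  by rewrite !nth_drop h //; lia.
by rewrite rev_drop; exact: prefix_take.
Qed.

Lemma measurable_bigcup_count d (X : measurableType d) (T : countType)
  (F : T -> set X) : (forall t, measurable (F t)) -> measurable (\bigcup_t F t).
Proof.
move=> mF; pose G n := if choice.unpickle n is Some t then F t else set0.
rewrite (_ : \bigcup_t F t = \bigcup_n G n).
  by apply: bigcup_measurable => n _; rewrite /G; case: choice.unpickle.
apply/seteqP; split=> [z [t _ Ft]|z [n _]].
  by exists (choice.pickle t) => //; rewrite /G choice.pickleK.
by rewrite /G; case: choice.unpickle => // t Ft; exists t.
Qed.

Section maximal.
Context {R : realType}.
Local Notation plane := (measurableTypeR R * measurableTypeR R)%type.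

Lemma strong_maximal_ge (h : R * R -> R) Q z : rect Q z ->
  (avg (fun w => `|h w|%R) Q <= strong_maximal h z)%E.
Proof. by move=> Qz; apply: ereal_sup_ubound; exists Q. Qed.

Lemma strong_maximal_ge0 (h : R * R -> R) z : (0 <= strong_maximal h z)%E.
Proof.
(* The unit dyadic square through [z] shows that the supremum is over a nonempty family. *)
have Qz : rect ((0, Num.floor z.1), (0, Num.floor z.2)) z.
  by split; apply/interval_set_floor; rewrite /= expr0z mulr1.
by apply: le_trans (strong_maximal_ge h Qz); exact: avg_ge0.
Qed.

Lemma avg_le (h : R * R -> R) Q (M : R) : 0 <= M ->
  (forall z, 0 <= h z <= M) -> measurable_fun setT (h : plane -> R) ->
  (avg h Q <= M%:E)%E.
Proof.
move=> M0 hM mh; have mR := measurable_rect (R := R) Q.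
apply: (@le_trans _ _ ((area R Q)^-1%:E * \int[leb2 R]_(z in rect Q) M%:E)%E).
  apply: lee_wpmul2l; first by rewrite lee_fin invr_ge0 ltW // area_gt0.
  apply: ge0_le_integral => //.
  - by move=> z _; rewrite lee_fin; have /andP[] := hM z.
  - by apply/measurable_EFinP; exact: measurable_funTS.
  - by move=> z _; rewrite lee_fin; have /andP[] := hM z.
rewrite integral_cst // [leb2 R (rect Q)](_ : _ = (area R Q)%:E); last first.
  by rewrite areaE leb2_rect.
by rewrite -!EFinM mulrCA mulVf ?mulr1 // gt_eqF // area_gt0.
Qed.

Lemma strong_maximal_le (h : R * R -> R) (M : R) z : 0 <= M ->
  (forall z, `|h z| <= M) -> measurable_fun setT (h : plane -> R) ->
  (strong_maximal h z <= M%:E)%E.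
Proof.
move=> M0 hM mh; apply: ub_ereal_sup => _ [Q _ <-]; apply: avg_le => //.
  by move=> w; rewrite normr_ge0 hM.
exact: measurableT_comp.
Qed.

(** A superlevel set is the union of the dyadic rectangles whose average exceeds the level, and
    there are countably many rectangles. *)
Lemma measurable_strong_maximal (h : R * R -> R) :
  measurable_fun setT (strong_maximal h : plane -> \bar R).
Proof.
move=> mT; apply: (measurability _ (ErealGenOInfty.measurableE R)) => //.
move=> _ [_ [x ->] <-]; rewrite setTI.
pose F Q : set plane :=
  if (x%:E < avg (fun w => `|h w|%R) Q)%E then rect Q else set0.
rewrite [X in measurable X](_ : _ = \bigcup_Q F Q); last first.
  apply/seteqP; split=> z; rewrite /= in_itv /= andbT.
    by move=> /ereal_sup_gt[_ [Q Qz <-] xQ]; exists Q => //; rewrite /F xQ.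
  move=> [Q _]; rewrite /F; case: ifPn => // xQ Qz.
  exact: lt_le_trans xQ (strong_maximal_ge h Qz).
apply: measurable_bigcup_count => Q; rewrite /F.
by case: ifP => // _; exact: measurable_rect.
Qed.

Lemma avg_step_ge (K : finType) m (c : R) (x y : K -> m.-tuple bool) p q i :
  0 <= c -> prefix p (x i) -> prefix q (y i) ->
  ((c * 2^-1 ^+ (m + m) * 2 ^+ (size p + size q))%:E <= avg (step c x y) (cell p q))%E.
Proof.
move=> c0 px qy; have mR := measurable_rect (R := R) (cell p q).
rewrite /avg integral_step // -EFinM lee_fin ler_pdivlMl ?area_gt0 // areaE /=.
have -> : (2 : R) ^ (- (size p)%:Z) * 2 ^ (- (size q)%:Z) *
    (c * 2^-1 ^+ (m + m) * 2 ^+ (size p + size q)) = c * (2^-1 ^+ m * 2^-1 ^+ m).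
  by rewrite -!exprnN !exprD; field; rewrite !expf_neq0.
rewrite (bigD1 i) //= -[leLHS]addr0 lerD //.
  rewrite setIidl ?leb2_cell ?size_tuple //.
  by move=> z [z1 z2]; split; [exact: code_prefix_sub z1|exact: code_prefix_sub z2].
by apply: sumr_ge0 => j _; rewrite mulr_ge0 // fine_ge0 // measure_ge0.
Qed.

Context (k : nat).
Local Notation m := (depth k).

Lemma strong_maximal_diag_ge z : windows k z != 0 :> R ->
  ((2 ^+ k)%:E <= strong_maximal (diag (R := R) k) z)%E.
Proof.
move=> /step_neq0[[s u] /= [z1 z2]]; set w := flip k s u in z2 *.
have sk : (s + k <= m)%N by have := ltn_ord s; have := depthE k; lia.
have zQ : rect (cell (take (s + k) u) (rev (drop s w))) z.
  split; [apply: code_prefix_sub z1|apply: code_prefix_sub z2].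
    exact: prefix_take.
  by rewrite rev_drop; exact: prefix_take.
apply: le_trans (strong_maximal_ge _ zQ); rewrite normr_diag.
(* [u] and [w] agree on the window, so they glue to one string [v], whose diagonal cell lies in the
   rectangle of area [2^-(m + k)]; its mass [2^-m] gives the average [2^k]. *)
pose v := [tuple if (t < s + k)%N then nth false u t else nth false w t | t < m].
have nthv t : (t < m)%N -> nth false v t =
    if (t < s + k)%N then nth false u t else nth false w t.
  by move=> tm; rewrite -[t]/(nat_of_ord (Ordinal tm)) -tnth_nth tnth_mktuple.
have pv : prefix (take (s + k) u) v.
  by apply: prefix_take_nth => t ts tm; rewrite nthv // ts.
have qv : prefix (rev (drop s w)) (rev v).
  apply: prefix_rev_drop_nth => t st tm; rewrite nthv // /w nth_flip // st /=.
  by case: ltnP => // _; rewrite addbF.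
apply: le_trans (avg_step_ge (i := v) _ pv qv); last exact: exprn_ge0.
rewrite size_rev size_drop size_take_min !size_tuple (minn_idPl sk) lee_fin.
have -> : (s + k + (m - s) = m + k)%N by lia.
rewrite !exprD !exprVn le_eqVlt; apply/orP; left; apply/eqP; field.
by rewrite expf_neq0.
Qed.

Lemma integral_windows : (\int[leb2 R]_z (windows k z)%:E = 1)%E.
Proof.
rewrite integral_step //; congr EFin.
under eq_bigr do rewrite setIT leb2_cell !size_tuple /=.
rewrite sumr_const card_prod card_ord card_tuple card_bool.
rewrite -[_ *+ (_ * _)]mulr_natr natrM !natrX.
by rewrite !exprVn; field; rewrite !expf_neq0.
Qed.

(** The maximal function inherits the bound [2^m] of [diag], and [windows] is integrable. *)
Lemma integrable_maximal_windows : (leb2 R).-integrable setT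
  (fun z => strong_maximal (diag k) z * (windows k z)%:E)%E.
Proof.
have mw : measurable_fun setT (windows k : plane -> R) by exact: step_measurable.
have ig : (leb2 R).-integrable setT (fun z : plane => (2 ^+ m)%:E * (windows k z)%:E)%E.
  by apply: integrableZl => //; exact: step_integrable.
apply: le_integrable ig => //.
- apply: emeasurable_funM; first exact: measurable_strong_maximal.
  exact/measurable_EFinP.
- move=> z _; rewrite !abseM lee_wpmul2r // gee0_abs ?strong_maximal_ge0 //.
  rewrite gee0_abs ?lee_fin ?exprn_ge0 //; apply: strong_maximal_le.
  + exact: exprn_ge0.
  + by move=> w; rewrite ger0_norm ?diag_ge0 ?diag_le.
  + exact: step_measurable.
Qed.

Lemma maximal_pairing_ge :
  ((2 ^+ k)%:E <= pairing (strong_maximal (diag k)) (EFin \o windows (R := R) k))%E.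
Proof.
have mw : measurable_fun setT (windows k : plane -> R) by exact: step_measurable.
have w0 z : (0 <= (windows k z : R)%:E)%E by rewrite lee_fin windows_ge0.
have k0 : (0 <= (2 ^+ k : R)%:E)%E by rewrite lee_fin exprn_ge0.
have mwE : measurable_fun setT (fun z : plane => (windows k z : R)%:E).
  exact/measurable_EFinP.
rewrite -[leLHS]mule1 -integral_windows -ge0_integralZl //.
apply: ge0_le_integral => //.
- by move=> z _; rewrite mule_ge0.
- by apply: emeasurable_funM => //; exact/measurable_EFinP.
- apply: emeasurable_funM; first exact: measurable_strong_maximal.
  exact/measurable_EFinP.
move=> z _ /=; have [->|nz] := eqVneq (windows k z : R) 0; first by rewrite !mule0.
by apply: lee_wpmul2r => //; exact: strong_maximal_diag_ge.
Qed.

End maximal.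

(** * Haar coefficients of step functions and the choice of signs *)

Section haar.
Context {R : realType}.
Local Notation plane := (measurableTypeR R * measurableTypeR R)%type.

(** Constant value of the Haar function of [code p] on the interval of a string [v] longer than
    [p]. *)
Definition haar_bits (p v : seq bool) : R :=
  len R (code p) `^ (- 2^-1) *
  ((prefix (rcons p false) v)%:R - (prefix (rcons p true) v)%:R).

Lemma indic_code (p v : seq bool) (x : R) : (size p <= size v)%N ->
  interval_set (code v) x -> \1_(interval_set (code p)) x = (prefix p v)%:R :> R.
Proof.
move=> pv xv; rewrite indicE; congr (nat_of_bool _)%:R; apply/idP/idP.
  by move=> /set_mem xp; exact: code_meet_prefix xp xv.
by move=> ppv; apply/mem_set; exact: code_prefix_sub xv.
Qed.

Lemma haarE (p v : seq bool) (x : R) : (size p < size v)%N ->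
  interval_set (code v) x -> haar (code p) x = haar_bits p v.
Proof.
move=> pv xv; rewrite /haar /haar_bits.
rewrite -(code_rcons p false) -(code_rcons p true).
by rewrite !(indic_code _ xv) ?size_rcons.
Qed.

Lemma prefix_rconsE (p v : seq bool) b : (size p < size v)%N ->
  prefix (rcons p b) v = prefix p v && (nth false v (size p) == b).
Proof.
move=> pv; rewrite !prefixE size_rcons (take_nth false pv) eqseq_rcons.
by [].
Qed.

Lemma normr_haar_bits (p v : seq bool) : (size p < size v)%N ->
  `|haar_bits p v| = len R (code p) `^ (- 2^-1) * (prefix p v)%:R.
Proof.
move=> pv; rewrite normrM ger0_norm ?powR_ge0 // !prefix_rconsE //.
congr (_ * _); case: prefix; case: nth;
  by rewrite //= ?subr0 ?sub0r ?normrN ?normr1 ?normr0.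
Qed.

Lemma haar_factor_sqr (p : seq bool) :
  len R (code p) `^ (- 2^-1) * len R (code p) `^ (- 2^-1) = 2 ^+ size p.
Proof.
rewrite lenE /= -exprnN -powRD; last by rewrite invr_eq0 expf_neq0 ?implybT.
have -> : - 2^-1 - 2^-1 = - 1 :> R by field.
by rewrite powR_inv1 ?invrK // invr_ge0 exprn_ge0.
Qed.

Lemma haar_coef_step (K : finType) m (c : R) (x y : K -> m.-tuple bool) p q :
  (size p < m)%N -> (size q < m)%N ->
  haar_coef (step c x y) (cell p q) =
  \sum_i c * (haar_bits p (x i) * haar_bits q (y i)) * (2^-1 ^+ m * 2^-1 ^+ m).
Proof.
move=> pm qm; rewrite /haar_coef /pairing.
rewrite (eq_integral (fun z : plane => (\sum_i
    c * (haar_bits p (x i) * haar_bits q (y i)) * \1_(rect (cell (x i) (y i))) z)%:E)); last first.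
  move=> z _ /=; rewrite -EFinM /step mulr_suml; congr EFin; apply: eq_bigr => i _.
  rewrite indicE; case: (boolP (z \in _)) => [/set_mem[z1 z2]|_]; last first.
    by rewrite !mulr0 mul0r.
  by rewrite /haar2 /= (haarE _ z1) ?(haarE _ z2) ?size_tuple // !mulr1.
rewrite integral_simple //=.
- apply: eq_bigr => i _; rewrite setIT leb2_cell /= !size_tuple.
  by [].
- by move=> i; exact: measurable_rect.
- by move=> i; rewrite leb2_cell ltry.
Qed.

(** Only one cell of the family lies in the rectangle, so no cancellation occurs and the single term
    gives the absolute value. *)
Lemma normr_haar_coef_step (K : finType) m (c : R) (x y : K -> m.-tuple bool)
    p q i0 : (size p < m)%N -> (size q < m)%N -> 0 <= c ->
  prefix p (x i0) -> prefix q (y i0) ->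
  (forall i, prefix p (x i) -> prefix q (y i) -> i = i0) ->
  `|haar_coef (step c x y) (cell p q)| =
    c * (len R (code p) `^ (- 2^-1) * len R (code q) `^ (- 2^-1)) *
    2^-1 ^+ (m + m).
Proof.
move=> pm qm c0 p0 q0 uni; rewrite haar_coef_step // (bigD1 i0) //= big1.
  have := normr_haar_bits (v := x i0); have := normr_haar_bits (v := y i0).
  rewrite addr0 !size_tuple => /(_ q qm); rewrite q0 mulr1 => eq.
  move=> /(_ p pm); rewrite p0 mulr1 => ep.
  have A0 : 0 <= (2^-1 : R) ^+ m by rewrite exprn_ge0.
  move: (haar_bits q (y i0)) (haar_bits p (x i0)) eq ep => a b eq ep.
  rewrite exprD; move: (2^-1 ^+ m) A0 => A A0.
  by rewrite !normrM eq ep !ger0_norm.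
move=> i ii0; have : ~~ (prefix p (x i) && prefix q (y i)).
  by apply/negP => /andP[h1 h2]; case/eqP: ii0; exact: uni.
have z r (v : m.-tuple bool) : (size r < m)%N -> ~~ prefix r v -> haar_bits r v = 0.
  move=> rm /negbTE rv; apply/eqP; rewrite -normr_eq0.
  by rewrite normr_haar_bits ?size_tuple // rv mulr0.
by rewrite negb_and => /orP[/z ->|/z ->] //; rewrite ?mul0r ?mulr0 ?mul0r.
Qed.

Section finite_sigma.
Context {T : finType} (h : T -> dyadic_rectangle) (f g : R * R -> R).

(** The signs make every term nonnegative; the value 0 off the range of [h] leaves a finite sum. *)
Definition sign_sigma (Q : dyadic_rectangle) : R :=
  if Q \in range h then Num.sg (haar_coef f Q * haar_coef g Q) else 0.

Lemma sign_sigma_le1 Q : `|sign_sigma Q| <= 1.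
Proof. by rewrite /sign_sigma; case: ifP => _; rewrite ?normr0 // normr_sg lern1 leq_b1. Qed.

Lemma martingale_term_sign Q : martingale_term sign_sigma f g Q =
  (if Q \in range h then `|haar_coef f Q * haar_coef g Q|%:E else 0%E).
Proof.
rewrite /martingale_term /sign_sigma; case: ifP => _; last by rewrite !mul0r.
by rewrite -mulrA -normrEsg.
Qed.

Lemma martingale_term_sign_ge0 Q : (0 <= martingale_term sign_sigma f g Q)%E.
Proof. by rewrite martingale_term_sign; case: ifP => // _; rewrite lee_fin. Qed.

Lemma esum_martingale_term_sign : injective h ->
  (\esum_(Q in setT) martingale_term sign_sigma f g Q =
   (\sum_t `|haar_coef f (h t) * haar_coef g (h t)|)%:E)%E.
Proof.
move=> hI; under eq_esum do rewrite martingale_term_sign.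
rewrite -esum_mkcond esum_fset; last 2 first.
- exact: finite_image.
- by move=> Q _; rewrite lee_fin.
rewrite fsbig_image; last by move=> s t _ _; exact: hI.
rewrite -sumEFin [RHS]fsbig_seq ?index_enum_uniq //; apply: eq_fsbigl.
by apply/seteqP; split=> t //= _; rewrite mem_index_enum.
Qed.

Lemma summable_martingale_sign : injective h ->
  summable setT (martingale_term sign_sigma f g).
Proof.
move=> hI; rewrite /summable.
under eq_esum do rewrite gee0_abs ?martingale_term_sign_ge0 //.
by rewrite esum_martingale_term_sign // ltry.
Qed.

Lemma martingale_pairing_sign : injective h ->
  martingale_pairing sign_sigma f g =
  (\sum_t `|haar_coef f (h t) * haar_coef g (h t)|)%:E.
Proof.
move=> hI; rewrite /martingale_pairing -esum_martingale_term_sign //.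
rewrite [X in (_ - X)%E]esum1 ?sube0.
  apply: eq_esum => Q _; rewrite (@ge0_funeposE _ _ setT) ?inE // => *.
  exact: martingale_term_sign_ge0.
move=> Q _; rewrite (@ge0_funenegE _ _ setT) ?inE // => *.
exact: martingale_term_sign_ge0.
Qed.

End finite_sigma.
End haar.

(** * Lower bound for the martingale transform *)

Lemma code_inj : injective code.
Proof.
move=> s t e; apply: bits_val_inj; last by have [] := congr1 snd e.
by have := congr1 fst e; rewrite /=; lia.
Qed.

Section martingale.
Context {R : realType} (k : nat) (k_gt0 : (0 < k)%N).
Local Notation m := (depth k).
Implicit Types (s : 'I_(4 ^ k - 2)) (u : m.-tuple bool).

Definition head_bits s u : seq bool := take (s.+1 + k) u.
Definition tail_bits s u : seq bool := rev (drop s.+1 u).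
(* The digits in the window [[s + 1, s + 1 + k)] are prescribed twice; the shift by
   one keeps both sides longer than [2^-m], so that Haar functions are constant on
   cells. *)
Definition overlap_rect (i : 'I_(4 ^ k - 2) * m.-tuple bool) : dyadic_rectangle :=
  cell (head_bits i.1 i.2) (tail_bits i.1 i.2).

Lemma window_lt s : (s.+1 + k < m)%N.
Proof. by have := ltn_ord s; have := depthE k; lia. Qed.

Lemma size_head s u : size (head_bits s u) = (s.+1 + k)%N.
Proof. by rewrite size_takel ?size_tuple // ltnW // window_lt. Qed.

Lemma size_tail s u : size (tail_bits s u) = (m - s.+1)%N.
Proof. by rewrite size_rev size_drop size_tuple. Qed.

Lemma prefix_headP s u (v : m.-tuple bool) : prefix (head_bits s u) v <->
  forall t, (t < s.+1 + k)%N -> nth false v t = nth false u t.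
Proof.
split=> [h t ts|h]; last by apply: prefix_take_nth => t ts tm; rewrite h.
by rewrite (prefix_nth h) ?size_head // nth_take.
Qed.

Lemma prefix_tailP s u (v : m.-tuple bool) : prefix (tail_bits s u) (rev v) <->
  forall t, (s < t)%N -> (t < m)%N -> nth false v t = nth false u t.
Proof.
split=> [h t st tm|h]; last by apply: prefix_rev_drop_nth => t st tm; rewrite h.
have sl := window_lt s.
rewrite (prefix_rev_nth h) ?size_tail ?size_tuple //; last by lia.
rewrite /tail_bits nth_rev ?size_drop ?size_tuple; last by lia.
by rewrite nth_drop; congr nth; lia.
Qed.

Lemma tuple_nth_eq u (v : m.-tuple bool) :
  (forall t, (t < m)%N -> nth false u t = nth false v t) -> u = v.
Proof.
by move=> h; apply: val_inj; apply: (@eq_from_nth _ false) => [|t];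
  rewrite !size_tuple // => /h.
Qed.

Lemma diag_in_overlap s u (v : m.-tuple bool) :
  prefix (head_bits s u) v -> prefix (tail_bits s u) (rev v) -> v = u.
Proof.
move=> /prefix_headP h1 /prefix_tailP h2; apply: tuple_nth_eq => t tm.
by case: (ltnP t (s.+1 + k)%N) => ts; [exact: h1|apply: h2 => //; lia].
Qed.

(** The number of head digits gives [s]; head and tail together then prescribe every digit of
    [u]. *)
Lemma overlap_rect_inj : injective overlap_rect.
Proof.
move=> [s u] [s' u'] [e1 e1' e2 e2'].
have hd : head_bits s u = head_bits s' u'.
  by apply: code_inj; rewrite /code; congr pair; [lia|congr Posz].
have tl : tail_bits s u = tail_bits s' u'.
  by apply: code_inj; rewrite /code; congr pair; [lia|congr Posz].
have es : s = s'.
  by apply: val_inj => /=; have := congr1 size hd; rewrite !size_head; lia.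
congr pair => //; symmetry; apply: (@diag_in_overlap s).
  by rewrite hd; exact: prefix_take.
by rewrite tl; apply/prefix_tailP.
Qed.

Lemma window_ord_lt s : (s.+1 < 4 ^ k)%N.
Proof. by have := ltn_ord s; lia. Qed.

(** Index of the only cell of [windows] in [overlap_rect (s, u)]: complementing [u] after the window
    is undone by [flip], so the second string has the prescribed tail. *)
Definition overlap_window s u : 'I_(4 ^ k) * m.-tuple bool :=
  (Ordinal (window_ord_lt s), [tuple nth false u t (+) (s.+1 + k <= t)%N | t < m]).

Lemma nth_overlap_window s u t : (t < m)%N ->
  nth false (overlap_window s u).2 t = nth false u t (+) (s.+1 + k <= t)%N.
Proof.
by move=> tm; rewrite -[t]/(nat_of_ord (Ordinal tm)) -tnth_nth tnth_mktuple.
Qed.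

Lemma overlap_window_head s u : prefix (head_bits s u) (overlap_window s u).2.
Proof.
apply/prefix_headP => t ts; have sl := window_lt s.
have tm : (t < m)%N by lia.
have e : (s.+1 + k <= t)%N = false by lia.
by rewrite (nth_overlap_window _ _ tm) e addbF.
Qed.

Lemma overlap_window_tail s u : prefix (tail_bits s u)
  (rev (flip k (overlap_window s u).1 (overlap_window s u).2)).
Proof.
apply/prefix_tailP => t st tm.
rewrite (nth_flip _ _ _ tm) (nth_overlap_window _ _ tm) /= st /=.
have -> : (t < s.+1 + k)%N = ~~ (s.+1 + k <= t)%N by rewrite -ltnNge.
by rewrite negbK -addbA addbb addbF.
Qed.

Lemma windows_in_overlap s u (i : 'I_(4 ^ k) * m.-tuple bool) :
  prefix (head_bits s u) i.2 -> prefix (tail_bits s u) (rev (flip k i.1 i.2)) ->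
  i = overlap_window s u.
Proof.
case: i => r v; rewrite -[(r, v).1]/r -[(r, v).2]/v =>
  /prefix_headP h1 /prefix_tailP h2; have sl := window_lt s.
have win t : (s < t)%N -> (t < s.+1 + k)%N -> (r <= t < r + k)%N.
  move=> st ts; have tm : (t < m)%N by lia.
  have := h2 t st tm; rewrite nth_flip // h1 //.
  by case: nth; case: (r <= t < r + k)%N.
(* The two strings agree on the doubly prescribed positions, so [[r, r + k)] contains both ends of
   [[s + 1, s + 1 + k)], which forces [r = s + 1]. *)
have /andP[r1 _] : (r <= s.+1 < r + k)%N by apply: win; lia.
have /andP[_ r2] : (r <= s + k < r + k)%N by apply: win; lia.
have er : r = Ordinal (window_ord_lt s) by apply: val_inj => /=; lia.
rewrite /overlap_window er; congr pair; apply: tuple_nth_eq => t tm.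
rewrite -[RHS]/(nth false (overlap_window s u).2 t) (nth_overlap_window _ _ tm).
case: (ltnP t (s.+1 + k)%N) => ts; first by rewrite h1 // addbF.
have := h2 t _ tm; rewrite nth_flip // er /= => <-; last by lia.
have -> : (s < t < s.+1 + k)%N = false by lia.
by rewrite /= -addbA addbb addbF.
Qed.

(** The two cells have masses [2^-m] and [2^-m / 4^k], and the squared Haar normalisation is the
    inverse area [2^(m + k)]. *)
Lemma haar_coefs_overlap i :
  `|haar_coef (diag k) (overlap_rect i) * haar_coef (windows k) (overlap_rect i)| =
  2 ^+ k / (4 ^+ k * 2 ^+ m) :> R.
Proof.
case: i => s u; have sl := window_lt s; rewrite normrM.
have h1 : (size (head_bits s u) < m)%N by rewrite size_head.
have h2 : (size (tail_bits s u) < m)%N by rewrite size_tail; lia.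
rewrite (normr_haar_coef_step (i0 := u)) ?exprn_ge0 //; last 3 first.
- exact/prefix_headP.
- exact/prefix_tailP.
- by move=> v; exact: diag_in_overlap.
have c0 : 0 <= 2 ^+ m / 4 ^+ k :> R by rewrite divr_ge0 ?exprn_ge0.
rewrite (normr_haar_coef_step (i0 := overlap_window s u)) //; last 3 first.
- exact: overlap_window_head.
- exact: overlap_window_tail.
- exact: windows_in_overlap.
have := haar_factor_sqr (R := R) (head_bits s u).
have := haar_factor_sqr (R := R) (tail_bits s u).
rewrite /= -/(head_bits s u) -/(tail_bits s u).
set y := len R (code (tail_bits s u)) `^ _; set x := len R (code (head_bits s u)) `^ _.
move=> ey ex; set A := 2^-1 ^+ _.
have -> : 2 ^+ m * (x * y) * A * (2 ^+ m / 4 ^+ k * (x * y) * A) =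
    (x * x) * (y * y) * (2 ^+ m * A * (2 ^+ m / 4 ^+ k) * A) by ring.
rewrite /A {A}; move: x y ex ey => x y -> ->; rewrite size_head size_tail -exprD.
have -> : (s.+1 + k + (m - s.+1) = m + k)%N by lia.
by rewrite !exprD !exprVn; field; rewrite !expf_neq0.
Qed.

Lemma sum_haar_coefs_overlap :
  2 ^+ k / 2 <= \sum_i `|haar_coef (diag k) (overlap_rect i) *
                         haar_coef (windows k) (overlap_rect i)| :> R.
Proof.
under eq_bigr do rewrite haar_coefs_overlap.
rewrite sumr_const card_prod card_ord card_tuple card_bool.
rewrite -[_ *+ (_ * _)]mulr_natr natrM natrX.
(* As [k] is positive, [N = 4^k] is at least 4 and [(N - 2) / N >= 1 / 2]. *)
have F4 : (4 <= 4 ^ k)%N by rewrite -[X in (X <= _)%N]expn1 leq_exp2l.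
rewrite natrB ?natrX; last by lia.
have : 4 <= 4 ^+ k :> R by rewrite -natrX ler_nat.
have : 0 < (2 : R) ^+ m by rewrite exprn_gt0.
have : 0 < (2 : R) ^+ k by rewrite exprn_gt0.
move: (2 ^+ k) (2 ^+ m) (4 ^+ k) => D P F D0 P0 F4'.
have F0 : 0 < F by apply: lt_le_trans F4'.
have -> : D / (F * P) * ((F - 2) * P) = D * ((F - 2) / F).
  by field; rewrite !gt_eqF.
by rewrite ler_wpM2l ?(ltW D0) // ler_pdivlMr //; lra.
Qed.

End martingale.

(** * Choice of the depth *)

Section choice_of_depth.
Context {R : realType}.

Lemma bernoulli_lt (d : R) n : 0 < d -> n%:R * d < (1 + d) ^+ n.
Proof.
move=> d0; elim: n => [|n IH]; first by rewrite mul0r expr0.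
have : 1 <= (1 + d) ^+ n by rewrite exprn_ege1 // lerDl ltW.
by rewrite exprS -natr1; nra.
Qed.

Lemma powR_exprn (x a : R) n : 0 <= x -> (x ^+ n) `^ a = (x `^ a) ^+ n.
Proof.
move=> x0; elim: n => [|n IH]; first by rewrite !expr0 powR1.
by rewrite !exprS powRM ?exprn_ge0 // IH.
Qed.

Lemma exists_depth (alpha B : R) : 0 < alpha -> alpha < 2^-1 -> 0 <= B ->
  exists2 k, (0 < k)%N & B * (depth k).+2%:R `^ alpha < 2 ^+ k.
Proof.
(* [q] is [2 / 4^alpha]; it exceeds 1 exactly because [alpha < 1 / 2], so its powers outgrow any
   constant. *)
move=> a0 a1 B0; pose q : R := 2 `^ (1 - 2 * alpha).
have qE : 4 `^ alpha * q = 2.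
  have -> : 4 = 2 `^ 2 :> R by rewrite powR_mulrn // -natrX.
  rewrite -powRrM -powRD; last by rewrite pnatr_eq0 implybT.
  have -> : 2 * alpha + (1 - 2 * alpha) = 1 by ring.
  by rewrite powRr1.
have q1 : 1 < q.
  rewrite [ltLHS](_ : 1 = 1 `^ (1 - 2 * alpha)); last by rewrite powR1.
  by rewrite gt0_ltr_powR ?nnegrE //; lra.
pose d := q - 1; have d0 : 0 < d by rewrite subr_gt0.
pose k := (Num.bound (2 * B / d)).+1.
exists k => //.
have kd : 2 * B < q ^+ k.+1.
  apply: lt_trans (_ : _ < k.+1%:R * d) _.
    rewrite -ltr_pdivrMr //; apply: lt_trans (archi_boundP _) _.
      by rewrite divr_ge0 ?mulr_ge0 // ltW.
    by rewrite ltr_nat.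
  have -> : q = 1 + d by rewrite /d addrC subrK.
  exact: bernoulli_lt.
(* Hence [(m + 2)^alpha <= (4^alpha)^(k + 1)]; the exponent [k + 1] costs the factor 2 in [kd]. *)
have hm : ((depth k).+2 <= 4 ^ k.+1)%N.
  have : (k < 4 ^ k)%N by exact: ltn_expl.
  by rewrite depthE expnS; move: (4 ^ k)%N => F; lia.
have p4 : 0 < 4 `^ alpha :> R by rewrite powR_gt0.
have hp : (depth k).+2%:R `^ alpha <= (4 `^ alpha) ^+ k.+1 :> R.
  rewrite -powR_exprn // ge0_ler_powR ?nnegrE ?exprn_ge0 //; first exact: ltW.
  by rewrite -natrX ler_nat.
apply: le_lt_trans (ler_wpM2l B0 hp) _.
rewrite -(@ltr_pM2l _ 2) // -exprS -[in ltRHS]qE exprMn mulrA mulrC.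
by rewrite ltr_pM2l ?exprn_gt0.
Qed.

End choice_of_depth.

(** * Comparison of the sparse bound with both lower bounds *)

Unset Implicit Arguments.

Theorem theorem4p6 (R : realType) (alpha : R)
    (alpha_gt0 : 0 < alpha) (alpha_lt : alpha < 2^-1)
    (C eta : R) (C_gt0 : 0 < C) (eta_gt0 : 0 < eta) (eta_lt1 : eta < 1) :
  (exists f g : R * R -> R,
    [/\ compactly_supported f /\ integrable2 f,
        compactly_supported g /\ integrable2 g,
        (@leb2 R).-integrable setT
          (fun z => strong_maximal f z * (g z)%:E)%E
      & forall S : set dyadic_rectangle, sparse eta S ->
          (C%:E * sparse_form (xlog_pow alpha) S f g
            < `|pairing (strong_maximal f) (EFin \o g)|)%E]) /\
  (exists (sigma : dyadic_rectangle -> R) (f g : R * R -> R),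
    [/\ forall Q, `|sigma Q| <= 1,
        compactly_supported f /\ integrable2 f,
        compactly_supported g /\ integrable2 g,
        summable setT (martingale_term sigma f g)
      & forall S : set dyadic_rectangle, sparse eta S ->
          (C%:E * sparse_form (xlog_pow alpha) S f g
            < `|martingale_pairing sigma f g|)%E]).
Proof.
(* The constant 32 is 16 from [sparse_form_le] times 2 from the lower bound [2^k / 2] of the
   martingale sum; one [k] serves both claims. *)
have [k k0 hk] := exists_depth alpha_gt0 alpha_lt
  (B := 32 * C / eta) (divr_ge0 (mulr_ge0 (ler0n _ _) (ltW C_gt0)) (ltW eta_gt0)).
have a1 : alpha <= 1 by lra.
have form S : sparse eta S ->
    (C%:E * sparse_form (xlog_pow alpha) S (diag k) (windows k) < (2 ^+ k / 2)%:E)%E.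
  move=> sS; apply: (@le_lt_trans _ _ (C%:E * (16 * (depth k).+2%:R `^ alpha / eta)%:E)%E).
    apply: lee_wpmul2l; first by rewrite lee_fin ltW.
    by apply: sparse_form_le => //; exact: ltW.
  rewrite -EFinM lte_fin ltr_pdivlMr //; apply: le_lt_trans hk.
  by rewrite le_eqVlt; apply/orP; left; apply/eqP; field; exact: lt0r_neq0.
have kk : 2 ^+ k / 2 <= 2 ^+ k :> R.
  by rewrite ler_pdivrMr // ler_peMr ?exprn_ge0 // ler1n.
have df : compactly_supported (diag (R := R) k) /\ integrable2 (diag (R := R) k).
  by split; [exact: step_compact|exact: step_integrable].
have wf : compactly_supported (windows (R := R) k) /\ integrable2 (windows (R := R) k).
  by split; [exact: step_compact|exact: step_integrable].
split.
  exists (diag k), (windows k); split=> //; first exact: integrable_maximal_windows.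
  move=> S /form h; apply: lt_le_trans h _; apply: le_trans (lee_abs _).
  by apply: le_trans (maximal_pairing_ge k); rewrite lee_fin.
exists (sign_sigma (@overlap_rect k) (diag k) (windows k)), (diag k), (windows k); split=> //.
- exact: sign_sigma_le1.
- exact/summable_martingale_sign/overlap_rect_inj.
move=> S /form h; apply: lt_le_trans h _; apply: le_trans (lee_abs _).
rewrite martingale_pairing_sign; last exact: overlap_rect_inj.
by rewrite lee_fin; exact: sum_haar_coefs_overlap.
Qed.
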